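(* Let $(\xi_j)_{j\ge 0}$ be independent, identically distributed random variables taking values in $\{-1,0,1\}$, and for $n\ge 1$ let $P(z):=\sum_{j=0}^n \xi_j z^j$. For $z\in\mathbb{C}$ let $D_z$ be the event that $z$ is a double root of $P$. If \[\max_{x\in\{-1,0,1\}} \mathbb{P}(\xi_0 = x) < \frac{1}{\sqrt{3}},\] then \[\mathbb{P}(P\text{ has a double root}) = \mathbb{P}\Big(\bigcup_{z\in\mathbb{C}} D_z\Big)=\mathbb{P}(D_{-1}\cup D_0\cup D_1) + o(n^{-2})\quad\text{as } n\to\infty.\]
   Context: Here $o(n^{-2})$ denotes a term $\delta_n$, where the sequence $(\delta_n)$ depends only on the distribution of $\xi_0$ and satisfies $\lim_{n\to\infty}\delta_n n^{2}=0$. A double root of $P$ means a root of multiplicity at least $2$. *)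

(* Defs.v *)
From HB Require Import structures.
From mathcomp Require Import all_boot all_order all_algebra.
From mathcomp Require Import boolp Rstruct complex.
Set Implicit Arguments. Unset Strict Implicit. Unset Printing Implicit Defensive.
Import Order.TTheory GRing.Theory Num.Theory.
Local Open Scope ring_scope.

Definition RR : rcfType := Rdefinitions.R.
Definition CC := complex RR.

Definition val3 (k : 'I_3) : int := (k%:Z - 1)%R.

Definition randpoly (n : nat) (xi : {ffun 'I_n.+1 -> 'I_3}) : {poly CC} :=
  \poly_(j < n.+1) ((val3 (xi (inord j)))%:~R : CC).

Definition double_root (p : {poly CC}) (z : CC) : Prop :=
  (('X - z%:P) ^+ 2 %| p)%R.

(* Law of (xi_0,...,xi_n) for i.i.d. xi_j with common law p on {-1,0,1}:
   probability of an event E (a set of outcomes). *)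
Definition prob (p : 'I_3 -> RR) (n : nat)
    (E : {ffun 'I_n.+1 -> 'I_3} -> Prop) : RR :=
  \sum_(xi : {ffun 'I_n.+1 -> 'I_3} | `[< E xi >]) \prod_(i < n.+1) p (xi i).

Definition is_distr3 (p : 'I_3 -> RR) : Prop :=
  (forall k, 0 <= p k) /\ \sum_(k < 3) p k = 1.

Definition cm1 : CC := -1.
Definition c0 : CC := 0.
Definition c1 : CC := 1.

(* Main.v *)
Require Import Defs.
From HB Require Import structures.
From mathcomp Require Import all_boot all_order all_algebra.
From mathcomp Require Import boolp Rstruct complex.
From mathcomp Require Import all_fingroup all_field zify ring lra.
Import Order.TTheory GRing.Theory Num.Theory.
Set Implicit Arguments.
Unset Strict Implicit.
Unset Printing Implicit Defensive.
Local Open Scope ring_scope.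

(** If [P] has a double root outside [{-1, 0, 1}], then [phi ^ 2] divides [P] for
    the minimal polynomial [phi] of an algebraic integer [w] outside
    [{-1, 0, 1}]. Let [d] be the degree of [phi], [L ~ log n], [D = K1 L], and let
    [rho < 1 / sqrt 3] be the largest atom.

    - If [d > D], reduce modulo 3, which loses nothing since [-1, 0, 1] are
      distinct modulo 3. For each of the [3 ^ d] monic polynomials [psi] of degree
      [d], divisibility by [psi ^ 2] determines the [2 d] lowest coefficients
      from the others and so has probability at most [rho ^ (2 d)]. The sum of
      [(3 rho ^ 2) ^ d] over [d > D] is negligible.

    - If [d <= D] and [w] is not a root of unity, then, by a quantitative form of
      Kronecker's theorem, some conjugate [al] of [w] has [|al| ^ M >= 3] with [M]
      of order [D ^ 2]. Then [P(al) = 0] determines the coefficients at the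
      multiples of [M] from the others, which has probability at most
      [rho ^ (n / M)]; there are only [exp (O (L ^ 2))] such [al].

    - If [d <= D] and [w] is a root of unity, its order [k] satisfies
      [totient k <= D], hence [k <= 2 D ^ 2], and [w] is not real. Now [P'(w) = 0]
      is used. Swapping the coefficients at two positions congruent modulo [k]
      preserves the distribution. Swaps at distances [k 2 ^ l], together with
      many swaps at one top distance [k 2 ^ h ~ n / polylog n], in the classes of
      [0] and [1] modulo [k], give a sum [s0 + s1 w] with [s0], [s1] independent,
      each of maximal atom [2 ^ - h] times a central binomial probability. As
      [1] and [w] are linearly independent over the reals, this gives a bound
      [o (n ^ -2)] even after summing over [w]. *)

(** * Product measures on finite functions *)

Section Probability.
Variables (R : realFieldType) (I T : finType) (p : T -> R).
Hypothesis p_ge0 : forall t, 0 <= p t.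
Hypothesis p_sum1 : \sum_t p t = 1.

Definition pr (E : {ffun I -> T} -> Prop) : R :=
  \sum_(f : {ffun I -> T} | `[< E f >]) \prod_i p (f i).

Lemma weight_ge0 (f : {ffun I -> T}) : 0 <= \prod_i p (f i).
Proof. by apply: prodr_ge0. Qed.

Lemma le_pr (E F : {ffun I -> T} -> Prop) :
  (forall f, E f -> F f) -> pr E <= pr F.
Proof.
move=> sEF; rewrite /pr big_mkcond [leRHS]big_mkcond.
apply: ler_sum => f _; case: asboolP => [Ef|_]; first by rewrite asboolT //; exact: sEF.
by case: ifP => // _; exact: weight_ge0.
Qed.

Lemma pr_total : pr (fun=> True) = 1.
Proof.
rewrite /pr (eq_bigl xpredT); last by move=> f; rewrite asboolT.
by rewrite -(bigA_distr_bigA (fun _ t => p t)) big1.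
Qed.

Lemma pr_or E F : pr (fun f => E f \/ F f) <= pr E + pr F.
Proof.
rewrite /pr big_mkcond [X in X + _]big_mkcond [X in _ + X]big_mkcond -big_split.
apply: ler_sum => f _; have w0 := weight_ge0 f.
case: (asboolP (E f)) => Ef; case: (asboolP (F f)) => Ff /=.
- by rewrite asboolT ?ler_wpDl //; left.
- by rewrite asboolT ?addr0 //; left.
- by rewrite asboolT ?add0r //; right.
- by rewrite asboolF ?addr0 // => -[].
Qed.

Lemma pr_bigcup (S : eqType) (s : seq S) (E : S -> {ffun I -> T} -> Prop) :
  pr (fun f => exists2 x, x \in s & E x f) <= \sum_(x <- s) pr (E x).
Proof.
elim: s => [|x s IHs].
  by rewrite big_nil /pr big_pred0 // => f; apply/asboolP => -[].
rewrite big_cons; apply: le_trans (lerD (lexx _) IHs).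
apply: le_trans (pr_or _ _); apply: le_pr => f [y].
by rewrite inE => /orP[/eqP-> ?|? ?]; [left|right; exists y].
Qed.

Lemma pr_bigcup_le (S : eqType) (s : seq S) (E : S -> {ffun I -> T} -> Prop) c :
  (forall x, x \in s -> pr (E x) <= c) ->
  pr (fun f => exists2 x, x \in s & E x f) <= (size s)%:R * c.
Proof.
move=> Ec; apply: le_trans (pr_bigcup _ _) _.
elim: s Ec => [|x s IHs] Ec; first by rewrite big_nil mul0r.
rewrite big_cons -natr1 mulrDl mul1r addrC lerD ?Ec ?mem_head //.
by apply: IHs => y sy; rewrite Ec // inE sy orbT.
Qed.

(** Condition on the coordinates outside [J]: an outcome weighs at most [rho ^+ #|J|] times the
    weight of those coordinates, a fibre of [E] holds at most [c] outcomes, and the outside weights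
    sum to one. *)
Lemma pr_fiber_bound (rho : R) (J : {set I}) (c : nat)
    (E : {ffun I -> T} -> Prop) :
  (forall t, p t <= rho) ->
  (forall g : {ffun I -> T},
     (#|[set f : {ffun I -> T} | `[< E f >] &
         [forall i, (i \in J) || (f i == g i)]]| <= c)%N) ->
  pr E <= c%:R * rho ^+ #|J|.
Proof.
move=> p_le Ec.
have [t0 _] : exists t0 : T, true.
  case: (pickP (@predT T)) => [t _|T0]; first by exists t.
  by move: p_sum1; rewrite big_pred0 // => /eqP; rewrite eq_sym oner_eq0.
have rho0 : 0 <= rho := le_trans (p_ge0 t0) (p_le t0).
(* [al] overwrites the coordinates in [J] with the dummy value [t0], so its values, which lie in
   [family F], label the fibres. *)
pose al (f : {ffun I -> T}) := [ffun i => if i \in J then t0 else f i].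
pose F i : pred T := if i \in J then pred1 t0 else predT.
have alF f : `[< E f >] -> al f \in family F.
  by move=> _; apply/familyP => i; rewrite ffunE /F; case: ifP => // _; rewrite inE.
rewrite /pr (partition_big al _ alF) /=.
have total : \sum_(g in family F) \prod_i (if i \in J then 1 else p (g i)) = 1.
  rewrite -(bigA_distr_big_dep F (fun i t => if i \in J then 1 else p t)).
  rewrite big1 // => i _; rewrite /F; case: ifP => _; first by rewrite big_pred1_eq.
  exact: p_sum1.
rewrite -[leRHS]mulr1 -[X in _ <= _ * X]total mulr_sumr; apply: ler_sum => g _.
set w := \prod_i _.
have w0 : 0 <= w by apply: prodr_ge0 => i _; case: ifP.
apply: (@le_trans _ _ (\sum_(f in [set f | `[<E f>] & al f == g]) rho ^+ #|J| * w)).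
  rewrite [leRHS](eq_bigl (fun f => `[<E f>] && (al f == g))); last by move=> f; rewrite inE.
  apply: ler_sum => f /andP[_ /eqP fg].
  rewrite (bigID (mem J)) /=; have -> : w = \prod_(i | i \notin J) p (f i).
    rewrite /w (bigID (mem J)) /= big1 ?mul1r; last by move=> i ->.
    by apply: eq_bigr => i iJ; rewrite (negPf iJ) -fg ffunE (negPf iJ).
  apply: ler_wpM2r; first exact: prodr_ge0.
  by rewrite -prodr_const; apply: ler_prod => i _; rewrite p_ge0 p_le.
rewrite sumr_const -[leLHS]mulr_natl -mulrA ler_wpM2r ?mulr_ge0 ?exprn_ge0 //.
rewrite ler_nat; apply: leq_trans (Ec g); apply: subset_leq_card.
apply/subsetP => f; rewrite !inE => /andP[-> /eqP fg] /=.
by apply/forallP => i; rewrite -fg ffunE; case: (i \in J) => //=.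
Qed.

Lemma pr_determined (rho : R) (J : {set I}) (E : {ffun I -> T} -> Prop) :
  (forall t, p t <= rho) ->
  (forall f g, E f -> E g -> (forall i, i \notin J -> f i = g i) -> f = g) ->
  pr E <= rho ^+ #|J|.
Proof.
move=> p_le Edet; rewrite -[leRHS]mul1r; apply: (pr_fiber_bound (c := 1)) => // g.
apply/card_le1P => f; rewrite inE => /andP[/asboolP Ef /forallP fg] h.
rewrite !inE; apply/andP/eqP => [[/asboolP Eh /forallP hg]|->].
  apply: Edet => // i iJ.
  by move: (fg i) (hg i); rewrite (negPf iJ) => /eqP-> /eqP->.
by split; [apply/asboolP|apply/forallP].
Qed.

(* The weight is invariant under permutations of the coordinates, so an event
   may be averaged over any finite family of them. *)
Lemma pr_average (A : finType) (s : A -> {perm I}) (c : R)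
    (E B : {ffun I -> T} -> Prop) :
  (0 < #|A|)%N -> 0 <= c ->
  (forall f : {ffun I -> T}, ~ B f ->
     #|[set a | `[< E [ffun i => f (s a i)] >]]|%:R <= c * #|A|%:R) ->
  pr E <= c + pr B.
Proof.
move=> A0 c0 Ec; have A0' : 0 < #|A|%:R :> R by rewrite ltr0n.
rewrite -(ler_pM2l A0') mulr_natl -sumr_const.
have reindexE a : pr E =
    \sum_(f : {ffun I -> T}) (if `[< E [ffun i => f (s a i)] >] then \prod_i p (f i) else 0).
  rewrite /pr big_mkcond (reindex (fun f : {ffun I -> T} => [ffun i => f (s a i)])) /=.
    apply: eq_bigr => f _; case: ifP => // _.
    rewrite [RHS](reindex_inj (@perm_inj _ (s a))).
    by apply: eq_bigr => i _; rewrite ffunE.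
  exists (fun f : {ffun I -> T} => [ffun i => f ((s a)^-1%g i)]) => f _;
    by apply/ffunP => i; rewrite !ffunE ?permK ?permKV.
rewrite (eq_bigr _ (fun a _ => reindexE a)) exchange_big /=.
rewrite mulrDr (mulrC _ c) -[X in X + _]mulr1 -[X in _ * X + _]pr_total /pr.
rewrite [X in _ * X + _]big_mkcond [X in _ + _ * X]big_mkcond /= !mulr_sumr -big_split.
apply: ler_sum => f _; have w0 := weight_ge0 f.
rewrite asboolT // -big_mkcond /= sumr_const -[leLHS]mulr_natl.
(* On [B] the trivial count [#|A|] is used; this produces the term [pr B]. *)
have [Bf|nBf] := asboolP (B f).
  rewrite ler_wpDl ?mulr_ge0 ?ler0n // ler_wpM2r // ler_nat.
  exact: max_card.
rewrite mulr0 addr0 ler_wpM2r //; apply: le_trans (Ec f nBf).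
by rewrite ler_nat; apply/subset_leq_card/subsetP => a; rewrite !inE.
Qed.

(** As [E] ignores coordinate [i], its slices at the various values of that coordinate share a
    common factor [K]; summing over the values gives [K = pr E]. *)
Lemma pr_indep (i : I) (t : T) (E : {ffun I -> T} -> Prop) :
  (forall f g : {ffun I -> T}, (forall j, j != i -> f j = g j) -> E f -> E g) ->
  pr (fun f => E f /\ f i = t) = p t * pr E.
Proof.
move=> Eind.
pose upd x (f : {ffun I -> T}) := [ffun j => if j == i then x else f j].
have Eupd x f : `[<E (upd x f)>] = `[<E f>].
  apply/asboolP/asboolP; apply: Eind => j /negPf ji; by rewrite ffunE ji.
pose K := \sum_(f : {ffun I -> T} | `[<E f>] && (f i == t)) \prod_(j | j != i) p (f j).
have slice x : \sum_(f | `[<E f>] && (f i == x)) \prod_j p (f j) = p x * K.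
  rewrite /K mulr_sumr (reindex_onto (upd x) (upd t)) /=; last first.
    move=> f /andP[_ /eqP fx]; apply/ffunP => j; rewrite !ffunE.
    by case: eqP => // ->.
  apply: eq_big => f.
    rewrite Eupd ffunE eqxx eqxx andbT; congr andb; apply/eqP/eqP => [<-|ft].
      by rewrite !ffunE eqxx.
    by apply/ffunP => j; rewrite !ffunE; case: eqP => // ->.
  move=> _; rewrite (bigD1 i) //= ffunE eqxx; congr (_ * _).
  by apply: eq_bigr => j /negPf ji; rewrite ffunE ji.
have -> : pr E = K.
  rewrite /pr (partition_big (fun f : {ffun I -> T} => f i) predT) //=.
  by rewrite (eq_bigr _ (fun x _ => slice x)) -mulr_suml p_sum1 mul1r.
rewrite -slice /pr; apply: eq_bigl => f.
by apply/asboolP/andP => -[? ?]; split; [apply/asboolP|apply/eqP|apply/asboolP|apply/eqP].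
Qed.

(** All positions involved are distinct, so the pairs are independent. The induction splits off the
    two coordinates of the first pair by [pr_indep] and passes to the complement. *)
Lemma pr_avoid_pairs (x y : T) (s : seq (I * I)) :
  uniq (unzip1 s ++ unzip2 s) ->
  pr (fun f => forall q, q \in s -> ~ (f q.1 = x /\ f q.2 = y)) =
    (1 - p x * p y) ^+ size s.
Proof.
elim: s => [|[a b] s IHs] /=.
  by move=> _; rewrite expr0 -pr_total; apply: eq_bigl => f; apply: asbool_equiv_eq.
rewrite mem_cat inE cat_uniq /= !negb_or.
rewrite -!andbA => /and4P[a1 ab a2 /and4P[u1 b1 ns /andP[b2 u2]]].
have {}IHs : _ := IHs _; rewrite exprS -IHs; last first.
  by rewrite cat_uniq u1 ns u2.
set E := fun f : {ffun I -> T} => forall q, q \in s -> ~ (f q.1 = x /\ f q.2 = y).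
have mem1 q : q \in s -> q.1 \in unzip1 s by apply: map_f.
have mem2 q : q \in s -> q.2 \in unzip2 s by apply: map_f.
have Eab : pr (fun f => (E f /\ f a = x) /\ f b = y) = p y * (p x * pr E).
  rewrite pr_indep; first rewrite pr_indep //.
    move=> f g fg Ef q sq; rewrite -!fg; first exact: Ef.
      by apply: contraNneq a2 => <-; exact: mem2.
    by apply: contraNneq a1 => <-; exact: mem1.
  move=> f g fg [Ef fa]; split; last by rewrite -fg.
  move=> q sq; rewrite -!fg; first exact: Ef.
    by apply: contraNneq b2 => <-; exact: mem2.
  by apply: contraNneq b1 => <-; exact: mem1.
rewrite mulrBl mul1r -(mulrC (p y)) -mulrA -Eab; apply/eqP; rewrite eq_sym subr_eq; apply/eqP.
rewrite /pr [RHS]addrC (bigID (fun f : {ffun I -> T} => (f a == x) && (f b == y))) /=.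
congr (_ + _); apply: eq_bigl => f.
  apply/andP/asboolP => [[/asboolP Ef /andP[/eqP fa /eqP fb]] //|[[Ef ->] ->]].
  by rewrite !eqxx; split=> //; apply/asboolP.
apply/andP/asboolP => [[/asboolP Ef nab] q|Ef].
  rewrite inE => /orP[/eqP->|]; last exact: Ef.
  by move=> -[/= fa fb]; rewrite fa fb !eqxx in nab.
split; first by apply/asboolP => q sq; apply: Ef; rewrite inE sq orbT.
apply/negP => /andP[/eqP fa /eqP fb].
by case: (Ef (a, b)); rewrite ?mem_head.
Qed.

End Probability.

(** * Graeffe iteration and traces of powers *)

Lemma coef_comp_polyNX (R : comNzRingType) (p : {poly R}) i :
  (p \Po (- 'X))`_i = (-1) ^+ i * p`_i.
Proof.
rewrite comp_polyE coef_sum.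
have sgC j : (-1) ^+ j = ((-1) ^+ j)%:P :> {poly R} by rewrite rmorphXn rmorphN1.
under eq_bigr => j _ do rewrite coefZ exprNn sgC coefCM coefXn.
have [ip|pi] := ltnP i (size p); last first.
  rewrite nth_default // mulr0 big1 // => j _.
  by rewrite gtn_eqF ?mulr0 ?(leq_trans (ltn_ord j)).
rewrite (bigD1 (Ordinal ip)) //= eqxx mulr1 mulrC big1 ?addr0 // => j ji.
by rewrite -val_eqE /= eq_sym in ji; rewrite (negPf ji) !mulr0.
Qed.

Lemma coef_comp_polyX2 (R : nzRingType) (p : {poly R}) i :
  (p \Po 'X^2)`_(i * 2)%N = p`_i.
Proof. by rewrite coef_comp_poly_Xn // dvdn_mull // mulnK. Qed.

Lemma comp_polyNXK (R : comNzRingType) (p : {poly R}) :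
  (p \Po (- 'X)) \Po (- 'X) = p.
Proof.
by apply/polyP => i; rewrite !coef_comp_polyNX signrMK.
Qed.

Lemma char_poly_comp (R : comNzRingType) n (A : 'M[R]_n) (q : {poly R}) :
  char_poly A \Po q = \det (q%:M - map_mx polyC A).
Proof.
rewrite /char_poly -(det_map_mx (comp_poly q)) /char_poly_mx map_mxB /=.
congr (\det (_ - _)); first by rewrite map_scalar_mx /= comp_polyX.
by apply/matrixP => i j; rewrite !mxE comp_polyC.
Qed.

(** Take determinants in X^2 - B^2 = (X - B)(X + B); the sign arises because substituting -X gives
    det(-(X + B)). *)
Lemma char_poly_graeffe (R : comNzRingType) n (B : 'M[R]_n.+1) :
  char_poly (B ^+ 2) \Po 'X^2 =
    (-1) ^+ n.+1 * (char_poly B * (char_poly B \Po (- 'X))).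
Proof.
rewrite !char_poly_comp.
have -> : (- 'X)%:M - map_mx polyC B = (-1) *: ('X%:M + map_mx polyC B) :> 'M_n.+1.
  by rewrite scaleN1r opprD raddfN.
rewrite detZ.

rewrite mulrCA signrMK.
rewrite /char_poly /char_poly_mx -det_mulmx; congr (\det _).
rewrite -[_ *m _]/(_ * _) mulrDr !mulrBl map_mxM /= -[_ *m _]/(_ * _).
have C : ('X%:M : 'M_n.+1) * map_mx polyC B = map_mx polyC B * 'X%:M.
  by rewrite -[RHS]/(_ *m _) scalar_mxC.
by rewrite C addrA subrK; congr (_ - _); rewrite expr2 scalar_mxM.
Qed.

(** The Frobenius map is additive in characteristic 2, and here it fixes every coefficient. *)
Lemma poly_sqr_idem (R : comNzRingType) (p : {poly R}) :
  2%N \in [pchar R] -> (forall x : R, x ^+ 2 = x) -> p ^+ 2 = p \Po 'X^2.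
Proof.
rewrite -pchar_poly => ch idem.
rewrite -[LHS](pFrobenius_autE ch) comp_polyE -{1}[p]coefK poly_def rmorph_sum /=.
apply: eq_bigr => i _.
by rewrite pFrobenius_autE exprZn idem -exprM mulnC exprM.
Qed.

Lemma char_poly_sqr_idem (R : comNzRingType) n (B : 'M[R]_n.+1) :
  2%N \in [pchar R] -> (forall x : R, x ^+ 2 = x) ->
  char_poly (B ^+ 2) = char_poly B.
Proof.
move=> ch idem; have chP : 2%N \in [pchar {poly R}] by rewrite pchar_poly.
have := char_poly_graeffe B; rewrite !oppr_pchar2 // expr1n mul1r comp_polyXr.
rewrite -expr2 (poly_sqr_idem (char_poly B)) // => e; apply/polyP => i.
by rewrite -coef_comp_polyX2 e coef_comp_polyX2.
Qed.

Lemma intr_Fp_eq0 (p : nat) (z : int) :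
  prime p -> (z%:~R == 0 :> 'F_p) = (p %| z)%Z.
Proof.
move=> pr; rewrite dvdzE absz_nat (dvdn_pcharf (pchar_Fp pr)).
by case: z => n //; rewrite NegzE rmorphN oppr_eq0 abszN.
Qed.

Definition poly_eqmod (m : int) (p q : {poly int}) :=
  forall i, (m %| p`_i - q`_i)%Z.

Lemma char_poly_sqr_mod2 n (B : 'M[int]_n.+1) :
  poly_eqmod 2 (char_poly (B ^+ 2)) (char_poly B).
Proof.
have idem (x : 'F_2) : x ^+ 2 = x by case: x => -[|[|[]]] // ?; apply/val_inj.
have := char_poly_sqr_idem (map_mx intr B) (pchar_Fp (isT : prime 2)) idem.
rewrite -rmorphXn -!map_char_poly => e i; rewrite -intr_Fp_eq0 // rmorphB subr_eq0.
have ci (p : {poly int}) : (map_poly (intr : int -> 'F_2) p)`_i = (p`_i)%:~R.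
  exact: coef_map.
by apply/eqP; rewrite -[LHS]ci -[RHS]ci e.
Qed.

Lemma poly_eqmodE m p q : poly_eqmod m p q -> exists H, p = q + m *: H.
Proof.
move=> e; exists (\poly_(i < size (p - q)) ((p - q)`_i %/ m)%Z).
apply/polyP => i; rewrite coefD coefZ coef_poly.
case: ltnP => [_|pq]; first by rewrite coefB mulrC divzK ?e // addrC subrK.
by move/(nth_default 0): pq => /eqP; rewrite coefB subr_eq0 mulr0 addr0 => /eqP.
Qed.

(** One Graeffe step gains one factor 2. With F = G + m H, the cross terms are m (u(X) + u(-X)),
    whose even coefficients are doubled, and m^2 is already divisible by 2^(k+2). *)
Lemma graeffe_eqmod k (F G : {poly int}) i : poly_eqmod (2 ^+ k.+1) F G ->
  (2 ^+ k.+2 %| (F * (F \Po (- 'X)))`_(i * 2)%N - (G * (G \Po (- 'X)))`_(i * 2)%N)%Z.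
Proof.
move=> /poly_eqmodE[H ->]; set m := 2 ^+ k.+1.
have mm : (2 ^+ k.+2 %| m * m)%Z.
  by rewrite /m -exprD; apply/dvdzP; exists (2 ^+ k); rewrite -exprD; congr (_ ^+ _); lia.
pose u := G * (H \Po (- 'X)).
have -> : (G + m *: H) * ((G + m *: H) \Po (- 'X)) =
   G * (G \Po (- 'X)) + (m *: (u + (u \Po (- 'X))) + (m * m) *: (H * (H \Po (- 'X)))).
  rewrite comp_polyD comp_polyZ /u comp_polyM comp_polyNXK.
  by rewrite -!mul_polyC !rmorphM /=; ring.
rewrite coefD addrC addKr coefD coefZ [X in _ + X]coefZ coefD coef_comp_polyNX.
rewrite mulnC exprM sqrrN !expr1n mul1r; apply: rpredD; last exact: dvdz_mulr.
by apply/dvdzP; exists (u`_(2 * i)%N); rewrite /m [in RHS]exprS; ring.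
Qed.

(** Start from the congruence modulo 2 and apply [graeffe_eqmod] at each squaring. *)
Lemma char_poly_pow2 n (B : 'M[int]_n.+1) k :
  poly_eqmod (2 ^+ k.+1) (char_poly (B ^+ (2 ^ k.+1))) (char_poly (B ^+ (2 ^ k))).
Proof.
elim: k => [|k IHk] i; first by rewrite expn1 expn0 expr1; exact: char_poly_sqr_mod2.
have coefE l : (char_poly (B ^+ (2 ^ l.+1)))`_i =
   (-1) ^+ n.+1 * (char_poly (B ^+ (2 ^ l)) * (char_poly (B ^+ (2 ^ l)) \Po (- 'X)))`_(i * 2)%N.
  have N1 : (-1 : {poly int}) ^+ n.+1 = ((-1) ^+ n.+1)%:P by rewrite rmorphXn rmorphN1.
  by rewrite -[LHS]coef_comp_polyX2 expnSr exprM char_poly_graeffe N1 coefCM.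
by rewrite !coefE -mulrBr dvdz_mull // graeffe_eqmod.
Qed.

Lemma mxtrace_pow2 n (B : 'M[int]_n.+1) k :
  (2 ^+ k.+1 %| \tr (B ^+ (2 ^ k.+1)) - \tr (B ^+ (2 ^ k)))%Z.
Proof.
have tr (A : 'M[int]_n.+1) := char_poly_trace A (ltn0Sn n).
by have := char_poly_pow2 B k n; rewrite !tr -opprD rpredN.
Qed.

(** * A quantitative Kronecker theorem *)

Lemma trig_mxM (R : pzRingType) n (A B : 'M[R]_n) :
  is_trig_mx A -> is_trig_mx B ->
  is_trig_mx (A *m B) /\ forall i, (A *m B) i i = A i i * B i i.
Proof.
move=> /is_trig_mxP tA /is_trig_mxP tB; split.
  apply/is_trig_mxP => i j ij; rewrite mxE big1 // => k _.
  by have [ki|ik] := leqP k i; [rewrite tB ?mulr0 ?(leq_ltn_trans ki)|rewrite tA ?mul0r].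
move=> i; rewrite mxE (bigD1 i) //= big1 ?addr0 // => k /negPf ki.
have [ik|/tA->] := leqP k i; last by rewrite mul0r.
by rewrite tB ?mulr0 // ltn_neqAle ik andbT; apply/negP => /eqP/val_inj/eqP; rewrite ki.
Qed.

(** Schur triangularisation: the diagonal of [T ^+ j] consists of [j]-th powers, and the diagonal of
    [T] is [rs] up to order because both split the same characteristic polynomial. *)
Lemma mxtrace_exp_roots n (A : 'M[algC]_n.+1) (rs : seq algC) j :
  char_poly A = \prod_(r <- rs) ('X - r%:P) ->
  \tr (A ^+ j) = \sum_(r <- rs) r ^+ j.
Proof.
move=> charA; have [P Pu] := Schur A (ltn0Sn n).
have {}Pu := unitarymx_unit Pu; set T := conjmx P A => trigT.
have TE : T = P *m A *m invmx P by rewrite /T conjumx.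
have TX i : T ^+ i = P *m A ^+ i *m invmx P.
  elim: i => [|i IHi]; first by rewrite !expr0 mulmx1 mulmxV.
  rewrite !exprSr IHi TE -[_ * (_ *m _ *m _)]/(_ *m _) !mulmxA mulmxKV //.
have trTX i : is_trig_mx (T ^+ i) /\ forall a, (T ^+ i) a a = T a a ^+ i.
  elim: i => [|i [tT dT]]; first by rewrite expr0; split; [exact: scalar_mx_is_trig|move=> a; rewrite mxE eqxx].
  rewrite exprSr; have [-> dM] := trig_mxM tT trigT; split=> // a.
  by rewrite [LHS]dM dT exprSr.
have charT : char_poly T = char_poly A.
  have Pm : map_mx polyC P \in unitmx by rewrite map_unitmx.
  rewrite /char_poly.
  have -> : char_poly_mx T = map_mx polyC P *m char_poly_mx A *m invmx (map_mx polyC P).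
    rewrite /char_poly_mx mulmxBr mulmxBl scalar_mxC mulmxK //.
    by rewrite TE !map_mxM map_invmx.
  by rewrite !det_mulmx det_inv mulrAC divrr ?mul1r // -unitmxE.
have rsE : perm_eq rs [seq T a a | a <- enum 'I_n.+1].
  apply: prod_XsubC_eq; rewrite -charA -charT char_poly_trig //.
  by rewrite big_map big_enum.
have -> : \tr (A ^+ j) = \tr (T ^+ j).
  by rewrite TX mxtrace_mulC mulmxA mulVmx ?mul1mx.
rewrite (perm_big _ rsE) big_map big_enum /=.
by apply: eq_bigr => a _; rewrite (trTX j).2.
Qed.

(** The companion matrix turns power sums into traces of an integer matrix [A], and [mxtrace_pow2]
    is applied to [A ^+ j]. *)
Lemma power_sum_int (phi : {poly int}) (rs : seq algC) k j :
  phi \is monic -> (1 < size phi)%N ->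
  map_poly intr phi = \prod_(r <- rs) ('X - r%:P) ->
  exists2 z : int, (2 ^+ k.+1 %| z)%Z &
    \sum_(r <- rs) r ^+ (j * 2 ^ k.+1) - \sum_(r <- rs) r ^+ (j * 2 ^ k) = z%:~R.
Proof.
move=> mon; case sz: (size phi) => [|[|n]] // _ rsE.
have [A charA] : exists A : 'M[int]_n.+1, char_poly A = phi.
  have : exists A : 'M[int]_((size phi).-1), char_poly A = phi.
    by exists (companionmx phi); exact: companionmxK.
  by rewrite sz.
have trE m : \sum_(r <- rs) r ^+ m = (\tr (A ^+ m))%:~R.
  rewrite -(@mxtrace_exp_roots n (map_mx intr A)); last by rewrite -map_char_poly charA.
  by rewrite -rmorphXn /= trace_map_mx.
exists (\tr (A ^+ (j * 2 ^ k.+1)) - \tr (A ^+ (j * 2 ^ k))).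
  by rewrite !exprM; exact: mxtrace_pow2.
by rewrite !trE rmorphB.
Qed.

(* Power sums of order at most twice the number of terms determine which values
   occur, so equality of those of [b] and [b ^+ 2] makes the values stable
   under squaring. *)
Lemma sqr_stable_of_power_sums (F : numFieldType) (S : seq F) d :
  (size S <= d)%N ->
  (forall j, (0 < j <= 2 * d)%N -> \sum_(b <- S) (b ^+ 2) ^+ j = \sum_(b <- S) b ^+ j) ->
  forall b, b \in S -> b ^+ 2 \in S.
Proof.
move=> szS psum c cS; apply/negPn/negP => c2S.
have psum' j : (j <= 2 * d)%N -> \sum_(b <- S) (b ^+ 2) ^+ j = \sum_(b <- S) b ^+ j.
  by case: j => [|j] jd; [apply: eq_bigr => b _; rewrite !expr0|exact: psum].
have lin (f : {poly F}) : (size f <= (2 * d).+1)%N ->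
    \sum_(b <- S) f.[b ^+ 2] = \sum_(b <- S) f.[b].
  move=> szf; under eq_bigr => b _ do rewrite (horner_coef_wide _ szf).
  rewrite exchange_big /=; under [RHS]eq_bigr => b _ do rewrite (horner_coef_wide _ szf).
  rewrite [RHS]exchange_big /=; apply: eq_bigr => i _.
  by rewrite -!mulr_sumr psum' // -ltnS.
(* The polynomial [f] vanishes at all values and all squares except [c ^+ 2], and has degree at most
   [2 * d]. Its sum over [S] is zero, while its sum over the squares is a positive multiple of
   [f.[c ^+ 2]], nonzero in characteristic 0. *)
pose s := [seq v <- S ++ [seq b ^+ 2 | b <- S] | v != c ^+ 2].
pose f := \prod_(v <- s) ('X - v%:P).
have rootf v : root f v = (v \in s) by rewrite root_prod_XsubC.
have /lin : (size f <= (2 * d).+1)%N.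
  rewrite size_prod_XsubC ltnS (leq_trans (size_subseq (filter_subseq _ _))) //.
  by rewrite size_cat size_map addnn -mul2n leq_mul2l.
rewrite [RHS]big1_seq => [|b /andP[_ bS]]; last first.
  apply/eqP; rewrite -[_ == 0]/(root f b) rootf mem_filter mem_cat bS andbT.
  by apply: contraNneq c2S => <-.
have fc : f.[c ^+ 2] != 0.
  by rewrite -[_ == 0]/(root f _) rootf mem_filter eqxx.
rewrite (bigID (fun b => b ^+ 2 == c ^+ 2)) /= [X in _ + X]big1_seq ?addr0; last first.
  move=> b /andP[bc bS]; apply/eqP; rewrite -[_ == 0]/(root f _) rootf mem_filter bc mem_cat.
  by apply/orP; right; apply/mapP; exists b.
rewrite (eq_bigr (fun=> f.[c ^+ 2])) => [|b /eqP-> //].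
rewrite big_const_seq iter_addr_0 => /eqP; rewrite mulrn_eq0 (negPf fc) orbF.
by rewrite eqn0Ngt -has_count => /negP; apply; apply/hasP; exists c.
Qed.

(** Pigeonhole: the iterated squares of [b] stay in the finite list [S], so two of them coincide. *)
Lemma root_of_unity_of_sqr_stable (F : fieldType) (S : seq F) (b : F) :
  (forall c, c \in S -> c ^+ 2 \in S) -> b \in S -> b != 0 ->
  exists2 m, (0 < m)%N & b ^+ m = 1.
Proof.
move=> sqS bS b0; pose u i := b ^+ (2 ^ i).
have uS i : u i \in S.
  by elim: i => [|i /sqS]; rewrite /u ?expr1 // -exprM -expnSr.
have /uniqPn : ~~ uniq [seq u i | i <- iota 0 (size S).+1].
  apply/negP => /uniq_leq_size le; suff: ((size S).+1 <= size S)%N by rewrite ltnn.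
  by rewrite -{1}(size_iota 0 (size S).+1) -(size_map u) le // => _ /mapP[i _ ->].
move=> /(_ 0)[i [j [ij]]]; rewrite size_map size_iota => jS.
rewrite !(nth_map 0%N) ?size_iota ?(ltn_trans ij) // !nth_iota ?(ltn_trans ij) // !add0n => uij.
have lt2 : (2 ^ i < 2 ^ j)%N by rewrite ltn_exp2l.
exists (2 ^ j - 2 ^ i)%N; first by rewrite subn_gt0.
apply: (mulfI (expf_neq0 (2 ^ i) b0)).
by rewrite mulr1 -exprD subnKC 1?ltnW.
Qed.

(* The power sums of the [2 ^ k]-th powers of
   the roots are small integers which are congruent modulo [2 ^ k] to those of
   the [2 ^ k.-1]-th powers, hence equal to them. *)
Lemma kronecker_house (phi : {poly int}) (rs : seq algC) D K :
  phi \is monic -> (1 < size phi)%N ->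
  map_poly intr phi = \prod_(r <- rs) ('X - r%:P) ->
  (size rs <= D)%N -> (6 * D < 2 ^ K)%N ->
  (forall r, r \in rs -> `|r| ^+ (2 ^ K * (2 * D)) < 3) ->
  forall r, r \in rs -> r != 0 -> exists2 m, (0 < m)%N & r ^+ m = 1.
Proof.
move=> mon szphi rsE szrs; case: K => [|k] DK small r rrs r0.
  suff: (0 < size rs)%N by lia.
  by case: (rs) rrs.
have bnd s m : s \in rs -> (m <= 2 ^ k.+1 * (2 * D))%N -> `|s ^+ m| <= 3.
  move=> srs mM; rewrite normrX; have [s1|s1] := real_leP (normr_real s) (real1 _).
    apply: (@le_trans _ _ 1); last by rewrite (ler_nat _ 1 3).
    exact: exprn_ile1.
  apply: le_trans (ltW (small s srs)); apply: ler_weXn2l => //; exact: ltW.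
have sbnd m : (m <= 2 ^ k.+1 * (2 * D))%N -> `|\sum_(s <- rs) s ^+ m| <= (3 * D)%:R.
  move=> mM; apply: le_trans (ler_norm_sum _ _ _) _.
  rewrite big_seq (le_trans (ler_sum _ (fun s srs => bnd s m srs mM))) //.
  rewrite -big_seq big_const_seq iter_addr_0 count_predT -mulrnA ler_nat.
  by rewrite leq_mul2l.
pose S := [seq s ^+ (2 ^ k) | s <- rs].
have [|||m m0 rm] := @root_of_unity_of_sqr_stable _ S (r ^+ (2 ^ k)).
- apply: (@sqr_stable_of_power_sums _ S D); first by rewrite size_map.
  move=> j /andP[j0 jD]; rewrite !big_map.
  have [z z2 zE] := power_sum_int k j mon szphi rsE.
  have e1 s : ((s ^+ (2 ^ k)) ^+ 2) ^+ j = s ^+ (j * 2 ^ k.+1) :> algC.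
    by rewrite -!exprM expnSr [in RHS]mulnC mulnA.
  have e2 s : (s ^+ (2 ^ k)) ^+ j = s ^+ (j * 2 ^ k) :> algC by rewrite -!exprM mulnC.
  under eq_bigr do rewrite e1; under [RHS]eq_bigr do rewrite e2.
  apply/eqP; rewrite -subr_eq0 zE intr_eq0.
  have : `|z%:~R : algC| <= (6 * D)%:R.
    rewrite -zE (le_trans (ler_normB _ _)) // (_ : 6 * D = 3 * D + 3 * D)%N; last lia.
    by rewrite natrD lerD // sbnd // ?expnS; nia.
  rewrite -intr_norm -[X in _ <= X]/((6 * D)%N%:~R) ler_int.
  (* A nonzero multiple of [2 ^ k.+1] would exceed the bound [6 * D], so the difference of power
     sums vanishes. *)
  have [-> //|z0] := eqVneq z 0; move: z2; rewrite dvdzE abszX -[`|2|%N]/2%N => /dvdn_leq.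
  by rewrite absz_gt0 => /(_ z0); lia.
- exact: map_f.
- by rewrite expf_neq0.
by exists (2 ^ k * m)%N; rewrite ?muln_gt0 ?expn_gt0 // exprM.
Qed.

(** * Subset sums *)

Lemma leq_bin_central m s : ('C(2 * m, s) <= 'C(2 * m, m))%N.
Proof.
have mono t : (t < m)%N -> ('C(2 * m, t) <= 'C(2 * m, t.+1))%N.
  move=> tm; rewrite -(leq_pmul2l (ltn0Sn t)) mul_bin_left leq_mul2r.
  by apply/orP; right; lia.
have below : forall t, (t <= m)%N -> ('C(2 * m, m - t) <= 'C(2 * m, m))%N.
  elim=> [|t IHt] tm; first by rewrite subn0.
  by apply: leq_trans (IHt (ltnW tm)); rewrite (_ : m - t = (m - t.+1).+1)%N ?mono //; lia.
have [sm|ms] := leqP s m; first by rewrite -[s](subKn sm) below ?leq_subr.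
have [s2|s2] := leqP s (2 * m); last by rewrite bin_small.
rewrite -bin_sub // (_ : 2 * m - s = m - (s - m))%N ?below //; lia.
Qed.

(** The ratio of consecutive central binomials is 2(2m+1)/(m+1), and the induction closes since
    (2m+1)^2 (3m+4) <= 4 (3m+1)(m+1)^2. *)
Lemma central_bin_sqr m : ('C(2 * m, m) ^ 2 * (3 * m + 1) <= 16 ^ m)%N.
Proof.
elim: m => [|m IHm] //.
have step : ('C(2 * m.+1, m.+1) * m.+1 = 2 * (2 * m + 1) * 'C(2 * m, m))%N.
  have e1 := mul_bin_down (2 * m).+1 m; have e2 := mul_bin_diag (2 * m).+2 m.
  have d : ((2 * m).+1 - m = m.+1)%N by lia.
  rewrite /= d in e1 e2; rewrite (_ : 2 * m.+1 = (2 * m).+2)%N; last by lia.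
  rewrite mulnC -e2; transitivity (2 * (m.+1 * 'C((2 * m).+1, m)))%N.
    by rewrite mulnA; congr muln; lia.
  by rewrite -e1 mulnA; congr muln; lia.
have m0 : (0 < m.+1 ^ 2)%N by [].
rewrite -(leq_pmul2r m0) mulnAC -expnMn step [(16 ^ _)%N]expnS.
apply: leq_trans (leq_mul (leq_mul (leqnn 16) IHm) (leqnn (m.+1 ^ 2))).
set c := 'C(_, _).
have le : (4 * ((2 * m + 1) * (2 * m + 1) * (3 * m.+1 + 1)) <=
           16 * ((3 * m + 1) * (m.+1 * m.+1)))%N by nia.
have := leq_mul (leqnn (c * c)) le; rewrite -!mulnn; lia.
Qed.

Lemma binary_digits_inj h (a b : nat -> bool) A B :
  (\sum_(l < h) a l * 2 ^ l + 2 ^ h * A = \sum_(l < h) b l * 2 ^ l + 2 ^ h * B)%N ->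
  (forall l, (l < h)%N -> a l = b l) /\ A = B.
Proof.
elim: h A B => [|h IHh] A B; first by rewrite !big_ord0 !expn0 !mul1n.
rewrite !big_ord_recr /= expnSr -!addnA => e.
have [|ab] := IHh (a h + 2 * A)%N (b h + 2 * B)%N.
  move: e; move: (2 ^ h)%N (a h : nat) (b h : nat) => X u v.
  by rewrite (mulnDr X u) (mulnDr X v) (mulnA X 2 A) (mulnA X 2 B) (mulnC X u) (mulnC X v).
move=> eh; have [ahbh AB] : a h = b h /\ A = B by move: eh; case: (a h); case: (b h) => /= ?; split => //; lia.
split=> // l; rewrite ltnS leq_eqVlt => /orP[/eqP->//|]; exact: ab.
Qed.

(** The weights are 1, 2, ..., 2^(h-1), followed by [2 * m] copies of 2^h. The total fixes the low
    choices as binary digits and fixes how many top weights are taken, leaving one binomial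
    coefficient of freedom. *)
Lemma card_subset_sums h m (t : nat) :
  (#|[set e : {ffun 'I_(h + 2 * m) -> bool} |
      \sum_l e l * 2 ^ minn l h == t]| <= 'C(2 * m, m))%N.
Proof.
set E := [set _ | _].
pose low (e : {ffun 'I_(h + 2 * m) -> bool}) l := if insub l is Some i then e i else false.
pose top (e : {ffun 'I_(h + 2 * m) -> bool}) := [set i : 'I_(2 * m) | e (rshift h i)].
have lowE e (l : 'I_h) : low e l = e (lshift (2 * m) l).
  by rewrite /low (valK (lshift (2 * m) l)).
have sumE (e : {ffun 'I_(h + 2 * m) -> bool}) :
    (\sum_l e l * 2 ^ minn l h = \sum_(l < h) low e l * 2 ^ l + 2 ^ h * #|top e|)%N.
  rewrite big_split_ord /=; congr addn.
    by apply: eq_bigr => l _; rewrite lowE (minn_idPl _) // ltnW.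
  rewrite -sum1_card big_distrr [RHS]big_mkcond; apply: eq_bigr => i _.
  rewrite inE (minn_idPr _) ?leq_addr //.
  by case: (e _); rewrite /= ?mul0n ?mul1n ?muln1.
case: (pickP (mem E)) => [e0 Ee0|E0]; last by rewrite eq_card0.
have digits e : e \in E -> (forall l, (l < h)%N -> low e l = low e0 l) /\ #|top e| = #|top e0|.
  move: Ee0; rewrite /= !inE => /eqP <- /eqP; rewrite !sumE => /binary_digits_inj.
  by [].
rewrite -(card_in_imset (f := top)); last first.
  move=> e e' /digits[le _] /digits[le' _] /setP tE; apply/ffunP => i.
  rewrite -(splitK i); case: (split i) => l /=; first by rewrite -!lowE le ?le'.
  by have := tE l; rewrite !inE.
apply: leq_trans (leq_bin_central m #|top e0|); rewrite -[X in 'C(X, _)]card_ord.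
rewrite -card_draws; apply/subset_leq_card/subsetP => _ /imsetP[e /digits[_ eT] ->].
by rewrite inE eT.
Qed.

Lemma card_pair_subset_sums h m (t : bool -> nat) :
  (#|[set e : {ffun bool * 'I_(h + 2 * m) -> bool} |
      [forall r, \sum_l e (r, l) * 2 ^ minn l h == t r]]| <= 'C(2 * m, m) ^ 2)%N.
Proof.
set E := [set _ | _].
pose S r := [set e : {ffun 'I_(h + 2 * m) -> bool} | \sum_l e l * 2 ^ minn l h == t r]%N.
pose part r (e : {ffun bool * 'I_(h + 2 * m) -> bool}) := [ffun l => e (r, l)].
rewrite -(card_in_imset (f := fun e => (part false e, part true e))); last first.
  move=> e e' _ _ [/ffunP ef /ffunP et]; apply/ffunP => -[[] l].
    by have := et l; rewrite !ffunE.
  by have := ef l; rewrite !ffunE.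
apply: leq_trans (_ : #|setX (S false) (S true)| <= _)%N; last first.
  by rewrite cardsX -mulnn leq_mul // card_subset_sums.
apply/subset_leq_card/subsetP => _ /imsetP[e + ->]; rewrite !inE => /forallP eE.
by rewrite -(eqP (eE false)) -(eqP (eE true)); apply/andP; split;
  apply/eqP; apply: eq_bigr => l _; rewrite ffunE.
Qed.

(** * Averaging over swaps *)

Section Swapping.
Variables (R : realFieldType) (I T : finType) (p : T -> R).
Hypothesis p_ge0 : forall t, 0 <= p t.
Hypothesis p_sum1 : \sum_t p t = 1.
Variables (Q : finType) (pos : Q * bool -> I).
Hypothesis pos_inj : injective pos.

(** [Q] indexes disjoint pairs of positions, the boolean names the two members of a pair, and [a]
    selects the pairs to exchange. *)
Definition swap_fun (a : {ffun Q -> bool}) (i : I) : I :=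
  if [pick u | pos u == i] is Some u then pos (u.1, a u.1 (+) u.2) else i.

Lemma swap_funE a u : swap_fun a (pos u) = pos (u.1, a u.1 (+) u.2).
Proof.
rewrite /swap_fun; case: pickP => [v /eqP/pos_inj-> //|/(_ u)].
by rewrite eqxx.
Qed.

Lemma swap_fun_inj a : injective (swap_fun a).
Proof.
apply: (can_inj (g := swap_fun a)) => i; rewrite {2}/swap_fun.
case: pickP => [[q b] /eqP <-|posF]; first by rewrite swap_funE /= addKb.
by rewrite /swap_fun; case: pickP => // u; rewrite posF.
Qed.

Definition swap_perm a : {perm I} := perm (@swap_fun_inj a).

(** After swapping, an additive statistic of [f] is a constant plus a subset sum in [a], to which
    the counts of subset sums apply. *)
Lemma sum_swap (V : zmodType) (F : I -> T -> V) a (f : {ffun I -> T}) :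
  \sum_i F i (f (swap_perm a i)) = \sum_i F i (f i) +
    \sum_q (F (pos (q, false)) (f (pos (q, true))) +
            F (pos (q, true)) (f (pos (q, false))) -
           (F (pos (q, false)) (f (pos (q, false))) +
            F (pos (q, true)) (f (pos (q, true))))) *+ a q.
Proof.
have splitE (G : I -> V) : \sum_i G i =
    \sum_(i | i \notin codom pos) G i + \sum_q (G (pos (q, false)) + G (pos (q, true))).
  rewrite (bigID (mem (codom pos))) /= addrC; congr (_ + _).
  rewrite -big_uniq /=; last by rewrite (map_inj_uniq pos_inj) enum_uniq.
  rewrite /codom /image_mem big_map big_enum /=.
  transitivity (\sum_q \sum_b G (pos (q, b))).
    by rewrite pair_bigA; apply: eq_bigr => -[].
  by apply: eq_bigr => q _; rewrite big_bool addrC.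
rewrite [LHS]splitE [X in _ = X + _]splitE -addrA -big_split; congr (_ + _).
  apply: eq_bigr => i iF; rewrite permE /swap_fun; case: pickP => // u /eqP ui.
  by rewrite -ui codom_f in iF.
apply: eq_bigr => q _; rewrite !permE !swap_funE /= addbF addbT.
by case: (a q); rewrite /= ?mulr0n ?addr0 // mulr1n addrC subrK.
Qed.

(** Only the pairs [sel b] are exploited: once the choices at all other pairs are fixed, at most [C]
    of the [2 ^ #|B|] remaining choices hit the target. *)
Lemma card_sum_fiber (V : zmodType) (B : finType) (D : Q -> V) (delta : B -> V)
    (sel : B -> Q) (C : nat) (t : V) :
  injective sel -> (forall b, D (sel b) = delta b) ->
  (forall v, #|[set e : {ffun B -> bool} | (\sum_b delta b *+ e b)%R == v]| <= C)%N ->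
  #|[set a : {ffun Q -> bool} | \sum_q D q *+ a q == t]|%:R <=
     C%:R / 2 ^+ #|B| * #|{ffun Q -> bool}|%:R :> R.
Proof.
move=> sel_inj Dsel cardC; set S := [set _ | _].
(* Counting is expressed through the uniform product measure so that [pr_fiber_bound] applies. *)
pose half (b : bool) : R := 2^-1.
have half0 b : 0 <= half b by rewrite invr_ge0.
have half1 : \sum_b half b = 1 by rewrite big_bool /half /=; lra.
have prS : pr half (fun a => a \in S) = #|S|%:R / #|{ffun Q -> bool}|%:R.
  rewrite /pr (eq_bigl (mem S)) => [|a]; last by apply/asboolP/idP.
  rewrite (eq_bigr (fun=> (2 ^+ #|Q|)^-1)) => [|a _]; last by rewrite prodr_const exprVn.
  by rewrite sumr_const card_ffun card_bool natrX -[LHS]mulr_natl.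
have N0 : 0 < #|{ffun Q -> bool}|%:R :> R by rewrite card_ffun card_bool ltr0n expn_gt0.
rewrite -ler_pdivrMr // -prS.
have <- : #|[set sel b | b : B]| = #|B| by rewrite card_imset.
rewrite -exprVn; apply: pr_fiber_bound => // g.
set J := [set sel b | b : B].
pose off := \sum_(q | q \notin J) D q *+ g q.
apply: leq_trans (cardC (t - off)).
have J_sel b : sel b \in J by apply: imset_f.
rewrite -(card_in_imset (f := fun a : {ffun Q -> bool} => [ffun b => a (sel b)])).
  apply/subset_leq_card/subsetP => _ /imsetP[a + ->].
  rewrite !inE => /andP[/asboolP/eqP <- /forallP ag].
  rewrite (bigID (mem J)) /= (_ : \sum_(q | q \notin J) _ = off); last first.
    by apply: eq_bigr => q /negPf qJ; move: (ag q); rewrite qJ => /eqP->.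
  rewrite addrK big_imset /=; last by move=> b c _ _; exact: sel_inj.
  by apply/eqP/eq_bigr => b _; rewrite ffunE Dsel.
move=> a a'; rewrite !inE => /andP[_ /forallP ag] /andP[_ /forallP a'g] /ffunP aa'.
apply/ffunP => q; have [/imsetP[b _ ->]|/negPf qJ] := boolP (q \in J).
  by have := aa' b; rewrite !ffunE.
by move: (ag q) (a'g q); rewrite qJ => /eqP-> /eqP->.
Qed.

End Swapping.

(** Each [b] owns [r] disjoint pairs of positions. Unless all of them fail to read [(x, y)], some
    pair does, and swapping it moves the sum by exactly [delta b]; averaging over all swaps then
    gives the first term. *)
Lemma pr_swap_bound (R : realFieldType) (I T : finType) (p : T -> R)
    (V : zmodType) (B : finType) (r : nat) (pos : (B * 'I_r) * bool -> I)
    (F : I -> T -> V) (delta : B -> V) (x y : T) (C : nat)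
    (E : {ffun I -> T} -> Prop) :
  (forall t, 0 <= p t) -> \sum_t p t = 1 -> injective pos ->
  (forall q, F (pos (q, false)) y + F (pos (q, true)) x -
             (F (pos (q, false)) x + F (pos (q, true)) y) = delta q.1) ->
  (forall v, #|[set e : {ffun B -> bool} | (\sum_b delta b *+ e b)%R == v]| <= C)%N ->
  (forall f, E f -> \sum_i F i (f i) = 0) ->
  pr p E <= C%:R / 2 ^+ #|B| + #|B|%:R * (1 - p x * p y) ^+ r.
Proof.
move=> p0 p1 pos_inj Fdelta cardC EF.
pose bad b (f : {ffun I -> T}) :=
  forall s, ~ (f (pos ((b, s), false)) = x /\ f (pos ((b, s), true)) = y).
have prbad : pr p (fun f => exists2 b, b \in enum B & bad b f) <=
    #|B|%:R * (1 - p x * p y) ^+ r.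
  rewrite cardE; apply: pr_bigcup_le => // b _.
  pose s := [seq (pos ((b, s), false), pos ((b, s), true)) | s <- enum 'I_r].
  have -> : r = size s by rewrite size_map size_enum_ord.
  rewrite -(pr_avoid_pairs p1).
    apply: le_pr => // f fb q /mapP[i _ ->] /=; exact: fb.
  have inj1 c : injective (fun i => pos ((b, i), c)) by move=> i j /pos_inj[].
  have -> : unzip1 s = [seq pos ((b, i), false) | i <- enum 'I_r].
    by rewrite /unzip1 -map_comp.
  have -> : unzip2 s = [seq pos ((b, i), true) | i <- enum 'I_r].
    by rewrite /unzip2 -map_comp.
  rewrite cat_uniq !map_inj_uniq -?enumT ?enum_uniq ?andbT //.
  by apply/hasPn => _ /mapP[i _ ->]; apply/mapP => -[j _ /pos_inj].
apply: le_trans (lerD (lexx _) prbad).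
apply: (pr_average p0 p1 (s := swap_perm pos_inj)) => [||f nbad].
- by rewrite card_ffun expn_gt0 card_bool.
- by rewrite divr_ge0 ?exprn_ge0.
have /boolp.choice[sel selP] b :
    exists s, f (pos ((b, s), false)) = x /\ f (pos ((b, s), true)) = y.
  apply: contrapT => nb; apply: nbad; exists b; first by rewrite mem_enum.
  by move=> s fs; apply: nb; exists s.
pose D q := F (pos (q, false)) (f (pos (q, true))) + F (pos (q, true)) (f (pos (q, false))) -
           (F (pos (q, false)) (f (pos (q, false))) + F (pos (q, true)) (f (pos (q, true)))).
apply: le_trans (card_sum_fiber R (D := D) (sel := fun b => (b, sel b)) (- \sum_i F i (f i)) _ _ cardC).
- rewrite ler_nat; apply/subset_leq_card/subsetP => a; rewrite !inE => /asboolP/EF.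
  under eq_bigr do rewrite ffunE.
  by rewrite sum_swap addrC => /eqP; rewrite addr_eq0.
- by move=> b c [].
- by move=> b; rewrite /D; have [-> ->] := selP b; rewrite Fdelta.
Qed.

(** * Roots of unity *)

Lemma radix_inj d a b a' b' : (b < d)%N -> (b' < d)%N ->
  (a * d + b = a' * d + b')%N -> a = a' /\ b = b'.
Proof.
move=> bd b'd e; have d0 : (0 < d)%N by exact: leq_ltn_trans bd.
have aa : a = a'.
  by have := congr1 (divn^~ d) e; rewrite /= !divnMDl // !divn_small // !addn0.
by split=> //; move: e; rewrite aa => /addnI.
Qed.

Section Layout.
Variables (h r m : nat).
Hypothesis small : (2 * m * r <= 2 ^ h)%N.

(* Pairs at distance [2 ^ l], [l < h], lie each in their own segment of length
   [2 ^ h.+1]; all those at distance [2 ^ h] share the first segment. *)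
Definition layout (l s : nat) (t : bool) : nat :=
  (if (l < h)%N then (l * r + s).+1 * 2 ^ h.+1 + t * 2 ^ l
   else (l - h) * r + s + t * 2 ^ h)%N.

Lemma layout_step l s : layout l s true = (layout l s false + 2 ^ minn l h)%N.
Proof.
rewrite /layout; case: ltnP => lh; rewrite mul1n mul0n addn0 //.
Qed.

Lemma top_lt l s : (h <= l < h + 2 * m)%N -> (s < r)%N -> ((l - h) * r + s < 2 ^ h)%N.
Proof.
move=> /andP[hl lm] sr; apply: leq_trans small.
have : (((l - h).+1) * r <= 2 * m * r)%N by rewrite leq_mul2r; apply/orP; right; lia.
by rewrite mulSn; lia.
Qed.

Lemma layout_lt l s t : (l < h + 2 * m)%N -> (s < r)%N ->
  (layout l s t < (h * r).+1 * 2 ^ h.+1)%N.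
Proof.
move=> lm sr; rewrite /layout; case: (ltnP l h) => lh.
  have pl : (2 ^ l <= 2 ^ h)%N by rewrite leq_exp2l // ltnW.
  have lr : ((l * r + s).+2 <= (h * r).+1)%N.
    have : (l.+1 * r <= h * r)%N by rewrite leq_mul2r lh orbT.
    by rewrite mulSn; lia.
  apply: leq_trans (leq_mul lr (leqnn _)); rewrite [X in (_ < X)%N]mulSn addnC ltn_add2r.
  by rewrite expnS; have := expn_gt0 2 h; case: t => /=; lia.
have : ((l - h) * r + s < 2 ^ h)%N by apply: top_lt => //; rewrite lh.
by rewrite mulSn expnS; case: t => /=; lia.
Qed.

(** Read the position in base [2 ^ h.+1]: the quotient is zero exactly for the top distance, where
    [small] leaves room to decode the rest in base [2 ^ h]. *)
Lemma layout_inj l s t l' s' t' :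
  (l < h + 2 * m)%N -> (s < r)%N -> (l' < h + 2 * m)%N -> (s' < r)%N ->
  layout l s t = layout l' s' t' -> [/\ l = l', s = s' & t = t'].
Proof.
have low_lt u (c : bool) : (u < h)%N -> (c * 2 ^ u < 2 ^ h.+1)%N.
  by move=> uh; case: c; rewrite ?mul1n ?mul0n ?expn_gt0 // ltn_exp2l // ltnS ltnW.
have high_lt u v (c : bool) : (h <= u < h + 2 * m)%N -> (v < r)%N ->
    ((u - h) * r + v + c * 2 ^ h < 2 ^ h.+1)%N.
  by move=> hu vr; have := top_lt hu vr; rewrite expnS; case: c => /=; lia.
rewrite /layout => lm sr lm' sr'; case: ltnP => lh; case: ltnP => lh'.
- move=> e; have [/succn_inj e' tt] := radix_inj (low_lt l t lh) (low_lt l' t' lh') e.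
  have [ll ss] := radix_inj sr sr' e'; split=> //.
  by move: tt (expn_gt0 2 l'); rewrite ll; case: (t) (t') => -[] //=; lia.
- rewrite -[RHS]add0n -(mul0n (2 ^ h.+1)%N) => e.
  have hu : (h <= l' < h + 2 * m)%N by rewrite lh'.
  by have [] := radix_inj (low_lt l t lh) (high_lt l' s' t' hu sr') e.
- rewrite -[LHS]add0n -(mul0n (2 ^ h.+1)%N) => e.
  have hu : (h <= l < h + 2 * m)%N by rewrite lh.
  by have [] := radix_inj (high_lt l s t hu sr) (low_lt l' t' lh') e.
rewrite ![(_ + _ * 2 ^ h)%N]addnC => e.
have hu : (h <= l < h + 2 * m)%N by rewrite lh.
have hu' : (h <= l' < h + 2 * m)%N by rewrite lh'.
have [tt e'] := radix_inj (top_lt hu sr) (top_lt hu' sr') e.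
have [ll ss] := radix_inj sr sr' e'; split=> //; first by lia.
by move: tt; case: (t); case: (t').
Qed.

End Layout.

Lemma nonreal_indep (w : algC) (a b a' b' : nat) : w \isn't Num.real ->
  a%:R + b%:R * w = a'%:R + b'%:R * w -> a = a' /\ b = b'.
Proof.
move=> wR e; have [bb|bb] := eqVneq b b'.
  by move: e; rewrite bb => /addIr/eqP; rewrite eqr_nat => /eqP.
case/negP: wR; have d0 : b%:R - b'%:R != 0 :> algC by rewrite subr_eq0 eqr_nat.
have -> : w = (a'%:R - a%:R) / (b%:R - b'%:R).
  apply: (mulIf d0); rewrite divfK //.
  have -> : a'%:R = a%:R + b%:R * w - b'%:R * w by rewrite e addrK.
  by ring.
by rewrite rpred_div // rpredB // ?realn.
Qed.

Lemma val3_inj : injective val3.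
Proof. by move=> x y /addIr [] /val_inj. Qed.

Lemma prob_root_of_unity (p : 'I_3 -> RR) (x y : 'I_3) (n k h m r : nat) (w : algC) :
  is_distr3 p -> x != y -> w \isn't Num.real -> (0 < k)%N -> w ^+ k = 1 ->
  (2 * m * r <= 2 ^ h)%N -> (k * ((h * r).+1 * 2 ^ h.+1) <= n)%N ->
  @prob p n (fun xi => \sum_(i < n.+1) (val3 (xi i))%:~R * i%:R * w ^+ i = 0) <=
    ('C(2 * m, m) ^ 2)%:R / 2 ^+ (2 * (h + 2 * m)) +
    (2 * (h + 2 * m))%:R * (1 - p x * p y) ^+ r.
Proof.
move=> [p0 p1] xy wR k0 wk small kn.
have k2 : (1 < k)%N.
  rewrite ltn_neqAle k0 andbT eq_sym; apply: contraNneq wR => k1.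
  by move: wk; rewrite k1 expr1 => ->; exact: real1.
pose B : finType := (bool * 'I_(h + 2 * m))%type.
(* The boolean in [B] is the residue class. Stretching the layout by [k] keeps a pair in one class,
   so both members carry the same power of [w], and a swap contributes [kap] times a power of two
   times 1 or [w]. *)
pose posn (u : (B * 'I_r) * bool) := (layout h r u.1.1.2 u.1.2 u.2 * k + u.1.1.1)%N.
have posn_lt u : (posn u < n.+1)%N.
  case: u => [[[c l] s] t]; rewrite /posn /= ltnS.
  have := layout_lt small t (ltn_ord l) (ltn_ord s); move: kn.
  move: (layout _ _ _ _ _) (_ * 2 ^ h.+1)%N => u v kn uv; apply: leq_trans kn.
  by have := leq_b1 c; nia.
pose pos u : 'I_n.+1 := Ordinal (posn_lt u).
have pos_inj : injective pos.
  move=> [[[c l] s] t] [[[c' l'] s'] t'] /(congr1 val); rewrite /= /posn /=.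
  have cb (d : bool) : (d < k)%N by apply: leq_ltn_trans (leq_b1 d) k2.
  move=> e; have [e' cc] := radix_inj (cb c) (cb c') e.
  have [/val_inj -> /val_inj -> ->] :=
    layout_inj small (ltn_ord l) (ltn_ord s) (ltn_ord l') (ltn_ord s') e'.
  by congr (_, _, _, _); move: cc; case: (c); case: (c').
pose F (i : 'I_n.+1) (t : 'I_3) : algC := (val3 t)%:~R * i%:R * w ^+ i.
pose kap : algC := ((val3 x)%:~R - (val3 y)%:~R) * k%:R.
have kap0 : kap != 0.
  rewrite mulf_neq0 ?pnatr_eq0 -?lt0n // subr_eq0 eqr_int.
  by apply: contraNneq xy => /val3_inj ->.
pose delta (b : B) : algC := kap * ((2 ^ minn b.2 h)%:R * w ^+ b.1).
have wpos u : w ^+ posn u = w ^+ u.1.1.1.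
  by rewrite exprD mulnC exprM wk expr1n mul1r.
have -> : (2 * (h + 2 * m) = #|B|)%N.
  by rewrite /B card_prod card_bool card_ord.
apply: (pr_swap_bound (pos := pos) (F := F) (delta := delta)) => //.
- move=> [[c l] s]; rewrite /F /delta /= !wpos /= /posn /= layout_step.
  by rewrite /kap !natrD !natrM !natrD; ring.
- move=> v; set S := [set _ | _].
  case: (pickP (mem S)) => [e0 Se0|S0]; last by rewrite eq_card0.
  pose N (e : {ffun B -> bool}) c := (\sum_l e (c, l) * 2 ^ minn l h)%N.
  have sumE (e : {ffun B -> bool}) : \sum_b delta b *+ e b = kap * ((N e false)%:R + (N e true)%:R * w).
    transitivity (\sum_c \sum_l delta (c, l) *+ e (c, l)).
      by rewrite pair_bigA; apply: eq_bigr => -[].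
    rewrite big_bool /= addrC mulrDr !natr_sum mulr_suml !mulr_sumr.
    congr (_ + _); apply: eq_bigr => l _; rewrite /delta /= natrM -[LHS]mulr_natr.
      by rewrite expr0; ring.
    by rewrite expr1; ring.
  apply: leq_trans (card_pair_subset_sums h m (N e0)).
  apply/subset_leq_card/subsetP => e; move: Se0; rewrite /= !inE => /eqP <- /eqP.
  rewrite !sumE => /(mulfI kap0)/(nonreal_indep wR)[Nf Nt].
  by apply/forallP => -[]; apply/eqP.
Qed.

(** * Determined coefficients *)

Definition intpoly (n : nat) (xi : {ffun 'I_n.+1 -> 'I_3}) : {poly int} :=
  \poly_(j < n.+1) val3 (xi (inord j)).

Lemma coef_intpoly n (xi : {ffun 'I_n.+1 -> 'I_3}) (i : 'I_n.+1) :
  (intpoly xi)`_i = val3 (xi i).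
Proof. by rewrite coef_poly ltn_ord inord_val. Qed.

Lemma val3_le1 t : `|val3 t| <= 1.
Proof. by case: t => -[|[|[]]]. Qed.

Lemma intpoly_coef_le1 n (xi : {ffun 'I_n.+1 -> 'I_3}) i : `|(intpoly xi)`_i| <= 1.
Proof. by rewrite coef_poly; case: ifP => // _; exact: val3_le1. Qed.

(** The factor [z] aligns the exponent with the position, so for a [k]-th root of unity the power
    depends only on the position modulo [k]. *)
Lemma horner_deriv_intpoly (R : comNzRingType) n (xi : {ffun 'I_n.+1 -> 'I_3}) (z : R) :
  z * ((map_poly intr (intpoly xi))^`()).[z] =
    \sum_(i < n.+1) (val3 (xi i))%:~R * i%:R * z ^+ i.
Proof.
rewrite (@horner_coef_wide _ n); last first.
  rewrite (leq_trans (size_poly _ _)) // -subn1 leq_subLR add1n.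
  by rewrite (leq_trans (size_poly _ _)) // size_poly.
rewrite [RHS]big_ord_recl mulr0 mul0r add0r mulr_sumr; apply: eq_bigr => i _.
rewrite coef_deriv coef_map -mulr_natr -(coef_intpoly xi (lift ord0 i)) lift0 exprS.
by ring.
Qed.

Lemma sum_expr_le (F : numDomainType) (B : nat) (b : F) N :
  B.+1%:R <= b -> B%:R * \sum_(i < N) b ^+ i <= b ^+ N - 1.
Proof.
move=> Bb; have b0 : 0 <= b by apply: le_trans Bb; rewrite ler0n.
elim: N => [|N IHN]; first by rewrite big_ord0 mulr0 expr0 subrr.
rewrite big_ord_recr /= mulrDr exprS; apply: le_trans (lerD IHN (lexx _)) _.
rewrite addrAC -[X in X + _ - _]mul1r -mulrDl lerD2r ler_wpM2r ?exprn_ge0 //.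
by rewrite addrC natr1.
Qed.

(** A nonzero integer leading coefficient has modulus at least 1, so by [sum_expr_le] the leading
    term strictly dominates the others. *)
Lemma poly_no_large_root (p : {poly int}) (B : nat) (z : algC) :
  (forall i, `|p`_i| <= B%:Z) -> B.+1%:R <= `|z| ->
  root (map_poly intr p) z -> p = 0.
Proof.
move=> pB Bz; have [->|pn0] := eqVneq p 0; first by [].
rewrite /root; have sz : size (map_poly (intr : int -> algC) p) = size p.
  by apply: size_map_inj_poly => //; exact: intr_inj.
rewrite horner_coef sz => /eqP e; exfalso; move: e.
have [N sN] : exists N, size p = N.+1 by exists (size p).-1; rewrite prednK // size_poly_gt0.
rewrite sN big_ord_recr /= => /eqP; rewrite addrC addr_eq0 => /eqP e.
have lN : 1 <= `|p`_N|.
  have : p`_N != 0 by rewrite -[N]/(N.+1.-1) -sN -lead_coefE lead_coef_eq0.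
  by lia.
have : `|z| ^+ N <= `|z| ^+ N - 1.
  apply: le_trans (sum_expr_le N Bz).
  have -> : `|z| ^+ N = 1 * `|z ^+ N| by rewrite mul1r normrX.
  have h1 : 1 <= `|(p`_N)%:~R| :> algC by rewrite -intr_norm ler1z.
  apply: le_trans (ler_wpM2r (normr_ge0 _) h1) _.
  rewrite -normrM -coef_map /= e normrN mulr_sumr; apply: le_trans (ler_norm_sum _ _ _) _.
  apply: ler_sum => i _; rewrite normrM normrX ler_wpM2r ?exprn_ge0 //.
  by rewrite coef_map /= -intr_norm -[X in _ <= X]/((B%:Z)%:~R) ler_int.
by rewrite lerBrDr gerDl lt_geF.
Qed.

Section Determined.
Variables (p : 'I_3 -> RR) (rho : RR) (n : nat).
Hypothesis p_distr : is_distr3 p.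
Hypothesis p_le : forall t, p t <= rho.

(** Two outcomes with equal coefficients from index [2 * d] on differ by a multiple of [psi ^+ 2] of
    degree below [2 * d], hence by zero. *)
Lemma prob_sqr_dvd_fixed (K : fieldType) d (psi : {poly K}) :
  injective (fun t => (val3 t)%:~R : K) -> (2 * d <= n.+1)%N ->
  size psi = d.+1 ->
  @prob p n (fun xi => psi ^+ 2 %| map_poly intr (intpoly xi)) <= rho ^+ (2 * d).
Proof.
case: p_distr => p0 p1 injK dn szpsi.
pose J := [set i : 'I_n.+1 | (i < 2 * d)%N].
have cJ : #|J| = (2 * d)%N.
  have wi : injective (widen_ord dn) by move=> i j /(congr1 val) /= /val_inj.
  rewrite -[RHS]card_ord -(card_imset _ wi).
  apply: eq_card => i; rewrite inE; apply/idP/imsetP => [id|[j _ ->]] //=.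
  by exists (Ordinal id) => //; apply/val_inj.
rewrite -cJ; apply: (pr_determined p0 p1) => // f g fd gd fg.
have dvd : psi ^+ 2 %| map_poly intr (intpoly f - intpoly g).
  by rewrite rmorphB dvdp_sub.
have psi0 : psi != 0 by rewrite -size_poly_gt0 szpsi.
have : map_poly intr (intpoly f - intpoly g) = 0 :> {poly K}.
  apply/eqP/negPn/negP => D0; have := dvdp_leq D0 dvd.
  have -> : size (psi ^+ 2) = (2 * d).+1 by rewrite expr2 size_mul // szpsi; lia.
  rewrite leqNgt => /negP; apply; rewrite ltnS.
  apply/leq_sizeP => j dj; rewrite coef_map coefB /=.
  have [jn|nj] := ltnP j n.+1; last by rewrite !coef_poly ltnNge nj subrr.
  by rewrite -[j]/(nat_of_ord (Ordinal jn)) !coef_intpoly fg ?subrr // inE -leqNgt.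
move=> D0; apply/ffunP => i; apply: injK.
have := congr1 (fun q : {poly K} => q`_i) D0.
rewrite coef_map coefB coef0 !coef_intpoly /= (mulrzBr 1 (val3 (f i))).
exact: subr0_eq.
Qed.

(** A unit leading coefficient preserves the degree of [phi] modulo 3; after normalisation the
    reduction is one of the [3 ^ d] polynomials [psi c]. *)
Lemma prob_sqr_dvd d : (2 * d <= n.+1)%N ->
  @prob p n (fun xi => exists phi r : {poly int},
     [/\ size phi = d.+1, lead_coef phi \is a GRing.unit & intpoly xi = phi ^+ 2 * r])
  <= (3 * rho ^+ 2) ^+ d.
Proof.
case: p_distr => p0 p1 dn.
have injK : injective (fun t => (val3 t)%:~R : 'F_3).
  by move=> [[|[|[|i]]] ti] [[|[|[|j]]] tj] //= _; apply/val_inj.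
pose psi (c : {ffun 'I_d -> 'F_3}) : {poly 'F_3} := 'X^d + \poly_(i < d) (if insub i is Some j then c j else 0).
have szpsi c : size (psi c) = d.+1.
  by rewrite size_polyDl size_polyXn // ltnS size_poly.
have := @pr_bigcup_le RR _ _ p p0 _ (enum {ffun 'I_d -> 'F_3})
  (fun c xi => psi c ^+ 2 %| map_poly intr (intpoly xi)) (rho ^+ (2 * d))
  (fun c _ => prob_sqr_dvd_fixed injK dn (szpsi c)).
rewrite -cardE card_ffun card_Fp // card_ord natrX exprM -exprMn; apply: le_trans.
apply: (le_pr p0) => xi [phi [r [szphi uphi ->]]].
pose q : {poly 'F_3} := map_poly intr phi.
have q_lead : (lead_coef phi)%:~R != 0 :> 'F_3.
  by rewrite -unitfE rmorph_unit.
pose q1 := (lead_coef phi)%:~R^-1 *: q.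
exists [ffun i : 'I_d => q1`_i]; first by rewrite mem_enum.
have -> : psi [ffun i : 'I_d => q1`_i] = q1.
  apply/polyP => i; rewrite coefD coefXn coef_poly; have [->|id] := eqVneq i d.
    rewrite ltnn addr0 coefZ coef_map /= lead_coefE szphi /= mulVf //.
    by move: q_lead; rewrite lead_coefE szphi.
  rewrite add0r; case: (ltnP i d) => [lid|dli].
    by rewrite insubT ffunE.
  have dli' : (d < i)%N by rewrite ltn_neqAle eq_sym id.
  by rewrite coefZ coef_map /= [phi`_i]nth_default ?mulr0 // szphi.
rewrite rmorphM rmorphXn /= -/q exprZn dvdp_mulr // dvdpZl //.
by rewrite expf_neq0 // invr_eq0.
Qed.

(** Two outcomes agreeing off the multiples of [M] differ by some C(X^M) with coefficients of
    modulus at most 2, and [C] has the root [al ^+ M] of modulus at least 3, so [C] is zero. *)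
Lemma prob_large_root (al : algC) (M : nat) : (0 < M)%N -> 3 <= `|al| ^+ M ->
  rho <= 1 ->
  @prob p n (fun xi => root (map_poly intr (intpoly xi)) al) <= rho ^+ (n %/ M).
Proof.
case: p_distr => p0 p1 M0 alM rho1.
have rho0 : 0 <= rho := le_trans (p0 ord0) (p_le ord0).
pose J := [set i : 'I_n.+1 | (M %| i)%N].
apply: le_trans (_ : rho ^+ #|J| <= _); last first.
  rewrite ler_wiXn2l // -[X in (X <= _)%N]card_ord.
  have bnd (i : 'I_(n %/ M)) : (i * M < n.+1)%N.
    by rewrite ltnS (leq_trans _ (leq_trunc_div n M)) // leq_mul2r ltnW ?orbT.
  rewrite -(card_imset (f := fun i => Ordinal (bnd i))); last first.
    by move=> i j [] /eqP; rewrite eqn_pmul2r // => /eqP/val_inj.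
  apply/subset_leq_card/subsetP => _ /imsetP[i _ ->].
  by rewrite inE dvdn_mull.
apply: (pr_determined p0 p1) => // f g fr gr fg.
pose C : {poly int} := \poly_(j < n.+1) (intpoly f - intpoly g)`_(j * M)%N.
have CE : intpoly f - intpoly g = C \Po 'X^M.
  apply/polyP => i; rewrite coef_comp_poly_Xn // coef_poly.
  have [iM|iM] := boolP (M %| i)%N.
    rewrite divnK //; case: ltnP => // ni; rewrite coefB !coef_poly !ifN ?subrr //.
      by rewrite -leqNgt (leq_trans ni) // leq_div.
    by rewrite -leqNgt (leq_trans ni) // leq_div.
  have [lin|nli] := ltnP i n.+1; last by rewrite coefB !coef_poly ltnNge nli subrr.
  by rewrite coefB (coef_intpoly f (Ordinal lin)) (coef_intpoly g (Ordinal lin)) fg ?subrr ?inE.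
have C0 : C = 0.
  apply: (@poly_no_large_root C 2 (al ^+ M)); last first.
  - have : root (map_poly intr (intpoly f - intpoly g)) al.
      by rewrite rmorphB rootE hornerD hornerN (eqP fr) (eqP gr) subrr.
    by rewrite CE map_comp_poly /= map_polyXn !rootE horner_comp hornerXn.
  - by rewrite normrX.
  move=> i; rewrite coef_poly; case: ifP => // _; rewrite coefB.
  by apply: le_trans (ler_normB _ _) _; rewrite (lerD (intpoly_coef_le1 _ _) (intpoly_coef_le1 _ _)).
apply/ffunP => i; apply: val3_inj; apply/eqP; rewrite -subr_eq0 -!coef_intpoly -coefB CE C0.
by rewrite comp_poly0 coef0.
Qed.

End Determined.

(** * Orders, coefficient bounds and double roots over the algebraic numbers *)

(** The extra factor for p = 2 is forced by the prime power 2 itself, whose totient is 1. In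
    [leq_totient] it is paid only once. *)
Lemma leq_totient_ppart p e : prime p -> (0 < e)%N ->
  (p ^ e <= (p == 2).+1 * totient (p ^ e) ^ 2)%N.
Proof.
move=> pr; case: e => // e _; rewrite totient_pfactor //= expnS.
have p1 := prime_gt1 pr.
have le : (p <= (p == 2).+1 * (p.-1 * p.-1))%N.
  case: eqP => [-> //|/eqP p2] /=.
  have : (2 < p)%N by rewrite ltn_neqAle eq_sym p2.
  by case: p {pr p1 p2} => // q; nia.
have e1 : (p ^ e <= p ^ e * p ^ e)%N by rewrite leq_pmulr // expn_gt0 prime_gt0.
by apply: leq_trans (leq_mul le e1) _; rewrite -mulnn; lia.
Qed.

Lemma leq_totient_odd k : odd k -> (k <= totient k ^ 2)%N.
Proof.
have [N] := ubnP k; elim: N k => // N IHN k kN ko.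
have k0 : (0 < k)%N by case: (k) ko.
have [k1|k1] := leqP k 1; first by have -> : k = 1%N by lia.
set p := pdiv k; have pr : prime p by exact: pdiv_prime.
have ko' : odd p by apply: dvdn_odd ko; exact: pdiv_dvd.
have e0 : (0 < logn p k)%N by rewrite logn_gt0 pi_pdiv.
have kE := partnC p k0; rewrite p_part in kE.
rewrite -[X in (X <= _)%N]kE -[X in totient X]kE totient_coprime; last first.
  by rewrite coprimeXl // prime_coprime // -(p'natE _ pr) part_pnat.
rewrite expnMn leq_mul //.
  have := leq_totient_ppart pr e0; case: eqP => [p2|_]; last by rewrite mul1n.
  by rewrite p2 in ko'.
apply: IHN; last by apply: dvdn_odd ko; exact: dvdn_part.
rewrite ltnS in kN; apply: leq_trans kN; rewrite -[X in (_ < X)%N]kE ltn_Pmull ?part_gt0 //.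
by rewrite -(exp1n (logn p k)) ltn_exp2r // prime_gt1.
Qed.

Lemma leq_totient k : (k <= 2 * totient k ^ 2)%N.
Proof.
case: (posnP k) => [-> //|k0].
have [e0|e0] := posnP (logn 2 k).
  have ko : odd k.
    rewrite -[odd k]negbK -dvdn2; apply/negP => d2.
    by move: e0; apply/eqP; rewrite -lt0n logn_gt0 mem_primes k0 d2.
  by apply: leq_trans (leq_totient_odd ko) _; rewrite leq_pmull.
have kE := partnC 2%N k0; rewrite p_part in kE.
have o2 : odd (k`_2^')%N.
  by rewrite -[odd _]negbK -dvdn2 -(p'natE _ (isT : prime 2)) part_pnat.
rewrite -[X in (X <= _)%N]kE -[X in totient X]kE totient_coprime; last by rewrite coprimeXl // prime_coprime // dvdn2 negbK.
rewrite expnMn mulnA leq_mul ?leq_totient_odd //.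
exact: (leq_totient_ppart (isT : prime 2) e0).
Qed.

Lemma coef_prod_XsubC_le (rs : seq algC) i : (forall r, r \in rs -> `|r| <= 2) ->
  `|(\prod_(r <- rs) ('X - r%:P))`_i| <= 3 ^+ size rs.
Proof.
elim: rs i => [|r rs IHrs] i rs2.
  by rewrite big_nil coef1; case: eqP; rewrite ?normr1 ?normr0 //= expr0.
have {}IHrs j := IHrs j (fun s srs => rs2 s (mem_behead (s := r :: rs) srs)).
rewrite big_cons mulrBl coefB coefXM coefCM /=; apply: le_trans (ler_normB _ _) _.
rewrite (_ : 3 ^+ _ = 3 ^+ size rs + 2 * 3 ^+ size rs); last by rewrite exprS; ring.
rewrite lerD //; first by case: eqP; rewrite ?normr0 ?exprn_ge0.
by rewrite normrM ler_pM // rs2 ?mem_head.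
Qed.

Lemma bounded_poly_roots D A : exists2 s : seq algC,
  (size s <= (2 * A).+1 ^ D.+1 * D)%N &
  forall (phi : {poly int}) al, phi != 0 -> (size phi <= D.+1)%N ->
    (forall i, `|phi`_i| <= A%:Z) -> root (map_poly intr phi) al -> al \in s.
Proof.
pose f (c : {ffun 'I_D.+1 -> 'I_(2 * A).+1}) : {poly int} :=
  \poly_(i < D.+1) ((c (inord i))%:Z - A%:Z).
(* Truncating to [D] roots gives the size bound for free, and loses nothing for the polynomials of
   size at most [D.+1] that matter. *)
pose rt (q : {poly algC}) := take D (sval (closed_field_poly_normal q)).
exists (flatten [seq rt (map_poly intr (f c)) | c <- enum {ffun 'I_D.+1 -> 'I_(2 * A).+1}]).
  have -> : ((2 * A).+1 ^ D.+1 = size (enum {ffun 'I_D.+1 -> 'I_(2 * A).+1}))%N.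
    by rewrite -cardE card_ffun !card_ord.
  elim: (enum _) => [|c s IHs] //=; rewrite size_cat (mulSn (size s) D) leq_add //.
  by rewrite size_take; case: ltnP => // /ltnW.
move=> phi al phi0 szphi phiA ral; apply/flattenP.
pose c : {ffun 'I_D.+1 -> 'I_(2 * A).+1} := [ffun i : 'I_D.+1 => inord `|phi`_i + A%:Z|].
have fc : f c = phi.
  apply/polyP => i; rewrite coef_poly; case: ltnP => [iD|/(leq_trans szphi)/(nth_default 0)-> //].
  by rewrite ffunE !inordK //; have := phiA i; lia.
exists (rt (map_poly intr (f c))); first by apply: map_f; rewrite mem_enum.
rewrite /rt fc; case: closed_field_poly_normal => rs /= rsE.
have mapphi0 : map_poly intr phi != 0 :> {poly algC}.
  by rewrite -size_poly_eq0 size_map_inj_poly ?size_poly_eq0 //; exact: intr_inj.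
have l0 : lead_coef (map_poly (intr : int -> algC) phi) != 0 by rewrite lead_coef_eq0.
have szrs : (size rs <= D)%N.
  rewrite -ltnS -(size_prod_XsubC rs id) -(size_scale _ l0) -rsE.
  by rewrite size_map_inj_poly //; exact: intr_inj.
by rewrite take_oversize // -root_prod_XsubC -(rootZ _ _ l0) -rsE.
Qed.

Lemma dvdp_XsubC_sqr (F : fieldType) (p : {poly F}) z :
  (('X - z%:P) ^+ 2 %| p) = root p z && root p^`() z.
Proof.
have [/factor_theorem[q ->]|nr] := boolP (root p z); last first.
  apply: contraNF nr => h; rewrite -dvdp_XsubCl; apply: dvdp_trans h.
  exact: dvdp_exp.
rewrite andTb expr2 dvdp_mul2r ?polyXsubC_eq0 // dvdp_XsubCl.
rewrite derivM derivB derivX derivC subr0 mulr1 !rootE hornerD hornerM hornerXsubC subrr.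
by rewrite mulr0 add0r.
Qed.

Lemma randpolyE n (xi : {ffun 'I_n.+1 -> 'I_3}) :
  randpoly xi = map_poly intr (intpoly xi).
Proof.
apply/polyP => i; rewrite coef_map !coef_poly.
by case: ifP.
Qed.

(** A rational polynomial whose roots in any field of characteristic 0 are the double roots; it
    carries them between [CC] and [algC]. *)
Definition gcd_deriv n (xi : {ffun 'I_n.+1 -> 'I_3}) : {poly rat} :=
  let P := map_poly intr (intpoly xi) in gcdp P P^`().

Lemma root_gcd_deriv (K : numFieldType) n (xi : {ffun 'I_n.+1 -> 'I_3}) (z : K) :
  root (map_poly ratr (gcd_deriv xi)) z =
    (('X - z%:P) ^+ 2 %| map_poly intr (intpoly xi)).
Proof.
rewrite /gcd_deriv gcdp_map root_gcd -deriv_map -map_poly_comp dvdp_XsubC_sqr.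
have e : map_poly (ratr \o intr : int -> K) (intpoly xi) = map_poly intr (intpoly xi).
  by apply: eq_map_poly => c; rewrite /= ratr_int.
by rewrite [map_poly (_ \o _) _]e.
Qed.

Lemma alg_double_root n (xi : {ffun 'I_n.+1 -> 'I_3}) (z : CC) :
  double_root (randpoly xi) z ->
  ~ (double_root (randpoly xi) cm1 \/ double_root (randpoly xi) c0
       \/ double_root (randpoly xi) c1) ->
  intpoly xi != 0 /\
  exists w : algC, [/\ w != 0, w != 1, w != -1,
    root (map_poly intr (intpoly xi)) w & root (map_poly intr (intpoly xi))^`() w].
Proof.
rewrite /double_root randpolyE => dz nD; split.
  by apply/eqP => P0; apply: nD; right; left; rewrite P0 map_poly0 dvdp0.
have G1 : size (gcd_deriv xi) != 1%N.
  apply: contraTneq dz => /eqP; rewrite -root_gcd_deriv => /size_poly1P[c c0' ->].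
  by rewrite map_polyC /= rootC fmorph_eq0.
have /closed_rootP[w rw] : size (map_poly (ratr : rat -> algC) (gcd_deriv xi)) != 1%N.
  by rewrite size_map_poly.
(* If [w] were 0, 1 or -1, the same rational number would be a double root over [CC], which is
   excluded. *)
have transfer (a : rat) : w = ratr a ->
    ('X - (ratr a : CC)%:P) ^+ 2 %| map_poly (intr : int -> CC) (intpoly xi).
  move=> wa; rewrite -root_gcd_deriv fmorph_root.
  by move: rw; rewrite wa fmorph_root.
exists w; move: (rw); rewrite root_gcd_deriv dvdp_XsubC_sqr => /andP[-> ->].
split=> //; apply/eqP => wE; apply: nD.
- by right; left; have := transfer 0; rewrite !rmorph0; apply.
- by right; right; have := transfer 1; rewrite !rmorph1; apply.
- by left; have := transfer (-1); rewrite !rmorphN1; apply.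
Qed.

(** * Trichotomy for the double root *)

(** Gauss's lemma: the minimal polynomial is proportional to an integer factor [p1] of [P], whose
    leading coefficient is 1 or -1 and hence its own inverse. *)
Lemma minCpoly_int (P : {poly int}) (w : algC) :
  lead_coef P \is a GRing.unit -> root (map_poly intr P) w ->
  exists phi : {poly int}, [/\ phi \is monic, map_poly intr phi = minCpoly w &
    forall q : {poly int}, root (map_poly intr q) w -> exists r, q = phi * r].
Proof.
move=> uP rP; have [p [pE pmon proot]] := minCpolyP w.
have ratrE (q : {poly int}) : map_poly (ratr : rat -> algC) (map_poly intr q) = map_poly intr q.
  by rewrite -map_poly_comp; apply: eq_map_poly => c; rewrite /= ratr_int.
have gauss (q : {poly int}) : root (map_poly intr q) w ->
    exists q1 r : {poly int}, q = q1 * r /\ map_poly intr q1 = (lead_coef q1)%:~R *: p.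
  rewrite -ratrE proot => /dvdpP_rat_int[q1 [a a0 pq1] [r ->]]; exists q1, r; split=> //.
  have /eqP := congr1 lead_coef pq1.
  rewrite (eqP pmon) lead_coefZ lead_coef_map_inj ?rmorph0 //; last exact: intr_inj.
  move=> /eqP l1; rewrite [X in _ *: X]pq1 scalerA mulrC -l1 scale1r //.
have [p1 [r [PE p1E]]] := gauss P rP.
have up1 : lead_coef p1 \is a GRing.unit.
  by move: uP; rewrite PE lead_coefM unitrM => /andP[].
have l1 : lead_coef p1 * lead_coef p1 = 1.
  by case/orP: up1 => /eqP->.
pose phi := lead_coef p1 *: p1.
have phiE : map_poly intr phi = p.
  by rewrite map_polyZ /= p1E scalerA -rmorphM l1 scale1r.
exists phi; split.
- by rewrite monicE lead_coefZ l1.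
- by rewrite pE -phiE ratrE.
move=> q /gauss[q1 [r1 [-> q1E]]]; exists (lead_coef q1 *: r1).
rewrite -scalerAr scalerAl; congr (_ * _).
apply: (map_inj_poly (f := intr : int -> rat)) => //; first exact: intr_inj.
by rewrite map_polyZ /= phiE q1E.
Qed.

Lemma unit_root_nonreal (w : algC) k : (0 < k)%N -> w ^+ k = 1 ->
  w != 1 -> w != -1 -> w \isn't Num.real.
Proof.
move=> k0 wk w1 wN1; apply/negP => wR.
have : `|w| == 1 by rewrite -(pexpr_eq1 k0) // -normrX wk normr1.
by rewrite real_eqr_norml // ler01 andbT (negPf w1) (negPf wN1).
Qed.

Lemma double_root_cases n (xi : {ffun 'I_n.+1 -> 'I_3}) (w : algC) D K (s : seq algC) :
  intpoly xi != 0 -> w != 0 -> w != 1 -> w != -1 ->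
  root (map_poly intr (intpoly xi)) w -> root (map_poly intr (intpoly xi))^`() w ->
  (6 * D < 2 ^ K)%N ->
  (forall (phi : {poly int}) al, phi != 0 -> (size phi <= D.+1)%N ->
    (forall i, `|phi`_i| <= (3 ^ D)%N%:Z) -> root (map_poly intr phi) al -> al \in s) ->
  [\/ exists2 d, (D < d)%N /\ (2 * d <= n)%N & exists phi r : {poly int},
        [/\ size phi = d.+1, lead_coef phi \is a GRing.unit & intpoly xi = phi ^+ 2 * r],
      exists2 k, (0 < k <= 2 * D ^ 2)%N /\ w ^+ k = 1 &
        w \isn't Num.real /\ \sum_(i < n.+1) (val3 (xi i))%:~R * i%:R * w ^+ i = 0 |
      exists2 al, al \in s & 3 <= `|al| ^+ (2 ^ K * (2 * D)) /\
        root (map_poly intr (intpoly xi)) al].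
Proof.
set P := intpoly xi => P0 w0 w1 wN1 rw rw' DK rs_s.
have lP : lead_coef P \is a GRing.unit.
  have := intpoly_coef_le1 xi (size P).-1; rewrite -/P -lead_coefE.
  by move: P0; rewrite -lead_coef_eq0 => + l1; rewrite /= => l0; apply/orP; lia.
have [phi [mon phiE phi_min]] := minCpoly_int lP rw.
have phi0 : phi != 0 by exact: monic_neq0.
have szmap : size (minCpoly w) = size phi.
  by rewrite -phiE size_map_inj_poly //; exact: intr_inj.
have rphi : root (map_poly intr phi) w by rewrite phiE root_minCpoly.
have sz1 : (1 < size phi)%N by rewrite -szmap size_minCpoly.
have [d dE] : exists d, size phi = d.+1 by exists (size phi).-1; rewrite prednK // ltnW.
have [r PE] := phi_min P rw.
have [dD|Dd] := leqP d D; last first.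
  (* With P = phi r and phi(w) = 0, the value P'(w) is phi'(w) r(w). By minimality phi'(w) is
     nonzero, so [w] is a root of [r] and [phi] divides [P] twice. *)
  apply: Or31; have [r' rE] : exists r', r = phi * r'.
    apply: (phi_min r); have nd : ~~ root (map_poly intr phi)^`() w.
      apply/negP; rewrite deriv_map => /phi_min[q dphi].
      have szd : (size phi^`() < size phi)%N by exact: lt_size_deriv.
      have d0 : phi^`() != 0.
        apply/eqP => /(congr1 (fun q : {poly int} => q`_d.-1)).
        rewrite coef_deriv coef0 prednK; last by move: sz1; rewrite dE.
        by move/eqP; rewrite mulrn_eq0 -[d]/(d.+1.-1) -dE -lead_coefE (monicP mon) oner_eq0 orbF; move: sz1; rewrite dE; case: (d).
      have q0 : q != 0 by apply: contraNneq d0 => q0; rewrite dphi q0 mulr0.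
      move: szd; rewrite dphi size_mul // ltnNge -subn1 -addnBA ?size_poly_gt0 //.
      by rewrite leq_addr.
    move: rw'; rewrite PE rmorphM derivM rootE hornerD !hornerM (eqP rphi) mul0r addr0.
    by rewrite mulf_eq0 -!rootE (negPf nd).
  have PE2 : P = phi ^+ 2 * r' by rewrite PE rE mulrA.
  exists d; last by exists phi, r'; rewrite (eqP mon) unitr1.
  split=> //; have r0 : r' != 0 by apply: contraNneq P0 => r0; rewrite PE2 r0 mulr0.
  have : (size P <= n.+1)%N by exact: size_poly.
  have sq : size (phi ^+ 2) = (2 * d).+1.
    by rewrite expr2 size_mul // dE; clear; lia.
  rewrite PE2 size_mul ?expf_neq0 // sq.
  by move: (size r') (size_poly_gt0 r') => t; rewrite r0; clear; lia.
have [wu|nwu] := pselect (exists2 m, (0 < m)%N & w ^+ m = 1).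
  case: wu => m m0 wm; apply: Or32.
  (* For the exact order [k], [phi] is cyclotomic, so [totient k] is its degree and [leq_totient]
     bounds [k]. *)
  have [k prk _] := prim_order_exists m0 wm.
  have k0 := prim_order_gt0 prk; have wk := prim_expr_order prk.
  exists k; last first.
    split; first exact: unit_root_nonreal wk _ _.
    by rewrite -horner_deriv_intpoly (eqP rw') mulr0.
  split=> //; rewrite k0; apply: leq_trans (leq_totient k) _.
  have : size phi = (totient k).+1 by rewrite -szmap (minCpoly_cyclotomic prk) size_cyclotomic.
  by rewrite dE => -[<-]; rewrite leq_mul2l leq_exp2r.
apply: Or33; have [rs rsE] := closed_field_poly_normal (map_poly (intr : int -> algC) phi).
have mm : map_poly (intr : int -> algC) phi \is monic by exact: monic_map.
rewrite (monicP mm) scale1r in rsE.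
have szrs : size rs = d.
  have := congr1 (fun q : {poly algC} => size q) rsE.
  rewrite /= size_prod_XsubC size_map_inj_poly //; last exact: intr_inj.
  by rewrite dE => -[].
have rootrs al : al \in rs -> root (map_poly intr phi) al by rewrite rsE root_prod_XsubC.
have rootP al : al \in rs -> root (map_poly intr P) al.
  by move=> /rootrs; rewrite PE rmorphM rootM => ->.
have wrs : w \in rs by rewrite -root_prod_XsubC -rsE.
have [al als big] : exists2 al, al \in rs & 3 <= `|al| ^+ (2 ^ K * (2 * D)).
  apply: contrapT => nbig; apply: nwu.
  apply: (kronecker_house mon sz1 rsE _ DK) wrs w0; first by rewrite szrs.
  move=> al als; rewrite real_ltNge ?rpredX ?normr_real ?realn //.
  by apply/negP => big; apply: nbig; exists al.
exists al; last by split=> //; exact: rootP.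
apply: (rs_s phi) => //; [by rewrite dE| |exact: rootrs].
(* All conjugates are roots of [P], hence of modulus at most 2, which bounds the coefficients of
   [phi] and puts [al] in the list [s]. *)
move=> i; have small r1 : r1 \in rs -> `|r1| <= 2.
  move=> /rootP r1P; rewrite real_leNgt ?normr_real ?realn //; apply/negP => r2.
  by case/eqP: P0; exact: poly_no_large_root (intpoly_coef_le1 xi) (ltW r2) r1P.
have := coef_prod_XsubC_le i small; rewrite -rsE coef_map /= szrs -intr_norm.
rewrite -(natrX _ 3) -[X in _ <= X]/(((3 ^ d)%N%:Z)%:~R) ler_int => /le_trans; apply.
by rewrite lez_nat leq_exp2l.
Qed.

(** * Union bounds *)

Lemma roots_of_unity_seq B : exists2 s : seq algC, (size s <= B ^ 2)%N &
  forall k w, (0 < k <= B)%N -> w ^+ k = 1 -> w \in s.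
Proof.
have zetaP (k : nat) : exists z : algC, (0 < k)%N -> k.-primitive_root z.
  have [k0|] := posnP k; first by exists 0; rewrite k0.
  by move=> /C_prim_root_exists[z zP]; exists z.
have /boolp.choice[zeta {}zetaP] := zetaP.
exists [seq zeta k ^+ j | k <- iota 1 B, j <- iota 0 B].
  by rewrite size_allpairs !size_iota mulnn.
move=> k w /andP[k0 kB] wk; have [i ->] := prim_rootP (zetaP k k0) wk.
apply/allpairsP; exists (k, val i); rewrite !mem_iota /= add0n add1n ltnS k0 kB.
by split=> //; exact: leq_trans (ltn_ord i) kB.
Qed.

Section Union.
Variables (p : 'I_3 -> RR) (rho : RR).
Hypothesis p_distr : is_distr3 p.
Hypothesis p_le : forall t, p t <= rho.
Hypothesis rho_small : 3 * rho ^+ 2 <= 1.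

Let rho_ge0 : 0 <= rho.
Proof. by case: p_distr => p0 _; exact: le_trans (p0 ord0) (p_le ord0). Qed.

Let rho_le1 : rho <= 1.
Proof. by rewrite -(@ler_sqr _ rho 1) ?nnegrE // expr1n; move: rho_small; lra. Qed.

Lemma prob_high_degree n D :
  @prob p n (fun xi => exists2 d, (D < d)%N /\ (2 * d <= n)%N &
    exists phi r : {poly int}, [/\ size phi = d.+1, lead_coef phi \is a GRing.unit &
      intpoly xi = phi ^+ 2 * r]) <= n.+1%:R * (3 * rho ^+ 2) ^+ D.
Proof.
case: (p_distr) => p0 p1; rewrite -[in n.+1%:R](size_iota 0 n.+1).
(* The constraints on [d] are moved into the event, so that inadmissible degrees contribute zero. *)
pose E (d : nat) (xi : {ffun 'I_n.+1 -> 'I_3}) := ((D < d)%N /\ (2 * d <= n)%N) /\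
    exists phi r : {poly int}, [/\ size phi = d.+1, lead_coef phi \is a GRing.unit &
      intpoly xi = phi ^+ 2 * r].
apply: le_trans (@pr_bigcup_le _ _ _ _ p0 _ (iota 0 n.+1) E _ _).
  apply: (le_pr p0) => xi [d [Dd dn] H]; exists d => //.
  by rewrite mem_iota add0n ltnS /=; lia.
have a0 : 0 <= 3 * rho ^+ 2 by rewrite mulr_ge0 ?exprn_ge0.
move=> d _; have [[Dd dn]|nd] := pselect ((D < d)%N /\ (2 * d <= n)%N).
  apply: le_trans (_ : (3 * rho ^+ 2) ^+ d <= _); last by rewrite ler_wiXn2l // ltnW.
  apply: le_trans (prob_sqr_dvd p_distr p_le (leqW dn)).
  by apply: (le_pr p0) => xi [].
rewrite /pr big_pred0 ?exprn_ge0 // => xi.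
by apply/asboolP => -[].
Qed.

Lemma prob_far_conjugate n M (s : seq algC) : (0 < M)%N ->
  @prob p n (fun xi => exists2 al, al \in s & 3 <= `|al| ^+ M /\
    root (map_poly intr (intpoly xi)) al) <= (size s)%:R * rho ^+ (n %/ M).
Proof.
case: (p_distr) => p0 p1 M0; apply: (pr_bigcup_le p0) => al _.
have [big|nbig] := pselect (3 <= `|al| ^+ M).
  apply: le_trans (prob_large_root n p_distr p_le M0 big rho_le1).
  by apply: (le_pr p0) => xi [].
rewrite /pr big_pred0 ?exprn_ge0 // => xi.
by apply/asboolP => -[].
Qed.

Lemma prob_low_order n B h m r (x y : 'I_3) : x != y ->
  (2 * m * r <= 2 ^ h)%N -> (B * ((h * r).+1 * 2 ^ h.+1) <= n)%N ->
  @prob p n (fun xi => exists w : algC, exists2 k, (0 < k <= B)%N /\ w ^+ k = 1 &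
     w \isn't Num.real /\ \sum_(i < n.+1) (val3 (xi i))%:~R * i%:R * w ^+ i = 0) <=
  (B ^ 2)%:R * ((4 ^+ h * m.+1%:R)^-1 + (2 * (h + 2 * m))%:R * (1 - p x * p y) ^+ r).
Proof.
case: (p_distr) => p0 p1 xy mr Bn.
have [s szs sP] := roots_of_unity_seq B.
have pxy : 0 <= 1 - p x * p y.
  have pl1 t : p t <= 1 by exact: le_trans (p_le t) rho_le1.
  by rewrite subr_ge0 -[1]mulr1 ler_pM.
set c := _ + _; have c0 : 0 <= c.
  by rewrite addr_ge0 ?invr_ge0 ?mulr_ge0 ?exprn_ge0.
apply: le_trans (_ : (size s)%:R * c <= _); last by rewrite ler_wpM2r // ler_nat.
pose E (w : algC) (xi : {ffun 'I_n.+1 -> 'I_3}) := exists2 k, (0 < k <= B)%N /\ w ^+ k = 1 &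
     w \isn't Num.real /\ \sum_(i < n.+1) (val3 (xi i))%:~R * i%:R * w ^+ i = 0.
apply: le_trans (@pr_bigcup_le _ _ _ _ p0 _ s E _ _).
  apply: (le_pr p0) => xi [w [k [kB wk] H]]; exists w; first exact: sP wk.
  by exists k.
move=> w _.
have [[k [/andP[k0 kB] wk] wR]|nk] := pselect (exists2 k, (0 < k <= B)%N /\ w ^+ k = 1 & w \isn't Num.real).
  apply: le_trans (le_trans (prob_root_of_unity (n := n) p_distr xy wR k0 wk mr _) _).
  - by apply: (le_pr p0) => xi [k' _ []].
  - by apply: leq_trans Bn; rewrite leq_mul2r kB orbT.
  (* The denominator is 4^h 16^m, and [central_bin_sqr] absorbs 16^m at the cost of a factor
     1/(m+1). *)
  rewrite /c lerD2r mulnDr mulnA -[(2 * 2)%N]/4%N exprD !exprM -!natrX.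
  rewrite -[(2 ^ 2)%N]/4%N -[(2 ^ 4)%N]/16%N !natrX invfM mulrA.
  rewrite mulrAC invfM mulrC ler_wpM2l ?invr_ge0 ?exprn_ge0 //.
  rewrite ler_pdivrMr ?exprn_gt0 // mulrC ler_pdivlMr ?ltr0n // -!natrX -natrM ler_nat.
  apply: leq_trans (central_bin_sqr m); rewrite leq_mul2l; apply/orP; right; lia.
rewrite /pr big_pred0 // => xi.
by apply/asboolP => -[k kB [wR _]]; apply: nk; exists k.
Qed.

Lemma prob_double_root_diff n D K M B h m r (x y : 'I_3) :
  (6 * D < 2 ^ K)%N -> M = (2 ^ K * (2 * D))%N -> (0 < M)%N -> B = (2 * D ^ 2)%N ->
  x != y -> (2 * m * r <= 2 ^ h)%N -> (B * ((h * r).+1 * 2 ^ h.+1) <= n)%N ->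
  `| @prob p n (fun xi => exists z : CC, double_root (randpoly xi) z)
     - @prob p n (fun xi => double_root (randpoly xi) cm1
                        \/ double_root (randpoly xi) c0
                        \/ double_root (randpoly xi) c1) | <=
  n.+1%:R * (3 * rho ^+ 2) ^+ D +
  (B ^ 2)%:R * ((4 ^+ h * m.+1%:R)^-1 + (2 * (h + 2 * m))%:R * (1 - p x * p y) ^+ r) +
  ((2 * 3 ^ D).+1 ^ D.+1 * D)%:R * rho ^+ (n %/ M).
Proof.
case: (p_distr) => p0 p1 DK ME M0 BE xy mr Bn.
set E1 := fun _ => exists _, _; set E2 := fun _ => _ \/ _.
have E21 (xi : {ffun 'I_n.+1 -> 'I_3}) : E2 xi -> E1 xi.
  by case=> [?|[?|?]]; [exists cm1|exists c0|exists c1].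
have le21 : prob p E2 <= prob p E1 by exact: (le_pr p0).
rewrite ger0_norm ?subr_ge0 // lerBlDl.
have [s szs sP] := bounded_poly_roots D (3 ^ D).
have := prob_far_conjugate n s M0; have := prob_low_order xy mr Bn.
have := prob_high_degree n D.
set A := prob p _ => leA; set C := prob p _ => leC; set F := prob p _ => leF.
apply: le_trans (_ : prob p E2 + (A + C + F) <= _); last first.
  rewrite lerD2l !lerD //; apply: le_trans leF _.
  by rewrite ler_wpM2r ?exprn_ge0 // ler_nat.
apply: le_trans (le_trans (pr_or p0 _ _) (lerD (lexx _) (le_trans (pr_or p0 _ _) (lerD (pr_or p0 _ _) (lexx _))))).
apply: (le_pr p0) => xi [z dz]; have [D2|nD2] := pselect (E2 xi); first by left.
right; have [P0 [w [w0 w1 wN1 rw rw']]] := alg_double_root dz nD2.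
have [A1|[k [kB wk] wR]|[al als [big ral]]] := double_root_cases P0 w0 w1 wN1 rw rw' DK sP.
- by left; left.
- by left; right; exists w, k; rewrite ?BE.
- by right; exists al => //; rewrite ME.
Qed.

End Union.

(** * Choice of the parameters *)

Lemma leq_pow_exp2 k L : (0 < k)%N -> (L ^ k <= k ^ k * 2 ^ L)%N.
Proof.
move=> k0; have Lk : (L <= 2 ^ (L %/ k) * k)%N.
  apply: leq_trans (ltnW (ltn_ceil L k0)) _; rewrite leq_mul2r; apply/orP; right.
  exact: ltn_expl.
apply: leq_trans (_ : (2 ^ (L %/ k) * k) ^ k <= _)%N; first by rewrite leq_exp2r.
by rewrite expnMn mulnC leq_mul2l -expnM leq_exp2l // leq_divM orbT.
Qed.

Lemma up_log_pow_small c e : exists N, forall n, (N <= n)%N ->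
  (c <= up_log 2 n)%N /\ (c * up_log 2 n ^ e <= n)%N.
Proof.
(* The factor [e.+1 ^ e.+1] is the loss in [leq_pow_exp2], and 2 the loss from rounding the
   logarithm. *)
pose C := (2 * c * e.+1 ^ e.+1 + c)%N; exists (2 ^ C.+1)%N => n Nn.
have n1 : (1 < n)%N by apply: leq_trans Nn; rewrite expnS; have := expn_gt0 2 C; lia.
have /andP[Ln nL] := up_log_bounds (isT : 1 < 2)%N n1; set L := up_log 2 n in Ln nL *.
have CL : (C.+1 <= L)%N by rewrite -(leq_exp2l (m := 2)) //; exact: leq_trans nL.
have cC : (c <= C)%N by rewrite leq_addl.
split; first by apply: leq_trans (leqW cC) CL.
have L0 : (0 < L)%N by exact: leq_trans CL.
have pL : (2 ^ L = 2 * 2 ^ L.-1)%N by rewrite -expnS prednK.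
apply: leq_trans (ltnW Ln); rewrite -(leq_pmul2l (isT : 0 < 2)%N) -pL.
have K0 : (0 < e.+1 ^ e.+1)%N by rewrite expn_gt0.
rewrite -(leq_pmul2l K0); apply: leq_trans (leq_pow_exp2 L (ltn0Sn e)).
rewrite [(L ^ e.+1)%N]expnS !mulnA leq_mul2r; apply/orP; right; apply: leq_trans (ltnW CL).
by rewrite /C; lia.
Qed.

(** The swaps use m = L^13 and r = K2 L. The power L^18 collects m, r and the factor L^4 by which
    2^h falls short of [n]; [G] is chosen so that the layouts fit for all orders up to 2 D^2. *)
Lemma parameters K1 K2 n : (0 < K1)%N -> (0 < K2)%N ->
  let L := up_log 2 n in let D := (K1 * L)%N in let G := (4 * K1 ^ 2 * K2.+1)%N in
  (0 < L)%N -> ((4 * K2.+1 * G + 720 * K1 ^ 4) * L ^ 18 <= n)%N ->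
  exists h K M,
    [/\ (6 * D < 2 ^ K)%N /\ M = (2 ^ K * (2 * D))%N, (0 < M)%N,
        (2 * L ^ 13 * (K2 * L) <= 2 ^ h)%N,
        (2 * D ^ 2 * ((h * (K2 * L)).+1 * 2 ^ h.+1) <= n)%N /\ (h <= L)%N &
        (n <= 2 * (2 ^ h * (G * L ^ 4)))%N /\
        (2 * (3 * D.+1 ^ 2 + 3 * L) <= n %/ M)%N].
Proof.
move=> K10 K20 L D G L0 big.
have n0 : (0 < n)%N.
  apply: leq_trans big; rewrite muln_gt0 [(0 < L ^ _)%N]expn_gt0 L0 andbT addn_gt0.
  by apply/orP; right; rewrite muln_gt0 expn_gt0 K10.
have nL : (n <= 2 ^ L)%N by exact: up_logP.
have D0 : (0 < D)%N by rewrite muln_gt0 K10.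
have G0 : (0 < G)%N by rewrite /G !muln_gt0 ?expn_gt0 K10.
have GL0 : (0 < G * L ^ 4)%N by rewrite muln_gt0 G0 expn_gt0 L0.
have big1 : (4 * K2.+1 * G * L ^ 18 <= n)%N.
  by apply: leq_trans big; rewrite mulnDl leq_addr.
have big2 : (720 * K1 ^ 4 * L ^ 4 <= n)%N.
  apply: leq_trans big; rewrite mulnDl; apply: leq_trans (leq_addl _ _).
  by rewrite leq_mul2l; apply/orP; right; rewrite leq_pexp2l.
have GLn : (G * L ^ 4 <= n)%N.
  apply: leq_trans big1; apply: leq_mul; last by rewrite leq_pexp2l.
  by rewrite leq_pmull.
pose h := trunc_log 2 (n %/ (G * L ^ 4)).
have q0 : (0 < n %/ (G * L ^ 4))%N by rewrite divn_gt0.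
have /andP[hq qh] := trunc_log_bounds (isT : 1 < 2)%N q0; rewrite -/h in hq qh.
rewrite leq_divRL // in hq; rewrite ltn_divLR // expnS -mulnA in qh.
(* [t.+1] is the least exponent with [6 * D < 2 ^ t.+1], which keeps [M] below 24 D^2. *)
pose t := trunc_log 2 (6 * D).
have D6 : (0 < 6 * D)%N by rewrite muln_gt0 D0.
have /andP[tD Dt] := trunc_log_bounds (isT : 1 < 2)%N D6.
rewrite -/t in tD Dt.
have hL : (h <= L)%N.
  rewrite -(leq_exp2l (m := 2)) //; apply: leq_trans nL; apply: leq_trans hq.
  by rewrite leq_pmulr.
exists h, t.+1, (2 ^ t.+1 * (2 * D))%N; split=> //.
- by rewrite muln_gt0 expn_gt0 muln_gt0 D0.
- rewrite leqNgt; apply/negP => hlt.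
  have : (n < 4 * K2.+1 * G * L ^ 18)%N.
    apply: leq_trans qh _; apply: leq_trans (_ : 2 * (2 * L ^ 13 * (K2 * L) * (G * L ^ 4)) <= _)%N.
      by rewrite leq_mul2l leq_mul2r (ltnW hlt) orbT.
    rewrite (_ : L ^ 18 = L ^ 13 * (L * L ^ 4))%N; last by rewrite -expnS -expnD.
    move: (L ^ 13)%N (L ^ 4)%N => u v; clear.
    rewrite (_ : 2 * _ = 4 * K2 * (G * (u * (L * v))))%N; last by lia.
    by rewrite -!mulnA leq_mul2l leq_mul2r leqnSn orbT.
  by rewrite ltnNge big1.
- split=> //; apply: leq_trans hq; rewrite [(2 ^ h.+1)%N]expnS.
  apply: leq_trans (_ : 2 ^ h * (4 * D ^ 2 * (h * (K2 * L)).+1) <= _)%N.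
    move: (2 ^ h)%N (D ^ 2)%N (h * (K2 * L))%N => u v z; clear.
    by rewrite leq_eqVlt; apply/orP; left; apply/eqP; lia.
  rewrite leq_mul2l; apply/orP; right.
  have le1 : ((h * (K2 * L)).+1 <= K2.+1 * L ^ 2)%N.
    have : (h * (K2 * L) <= L * (K2 * L))%N by rewrite leq_mul2r hL orbT.
    have : (0 < L * L)%N by rewrite muln_gt0 L0.
    by rewrite -mulnn; clear; lia.
  apply: leq_trans (leq_mul (leqnn _) le1) _.
  have L4 : (L ^ 4 = L ^ 2 * L ^ 2)%N by rewrite -expnD.
  rewrite /D /G expnMn L4; move: (L ^ 2)%N (K1 ^ 2)%N => u v; clear.
  by rewrite leq_eqVlt; apply/orP; left; apply/eqP; lia.
split; first exact: ltnW.
rewrite leq_divRL; last by rewrite muln_gt0 expn_gt0 muln_gt0 D0.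
apply: leq_trans big2.
have M24 : (2 ^ t.+1 * (2 * D) <= 24 * (D * D))%N by rewrite expnS; move: tD; clear; nia.
apply: leq_trans (leq_mul (leqnn _) M24) _.
have D1 : (D.+1 <= 2 * D)%N by lia.
have DD : (D.+1 ^ 2 <= 4 * (D * D))%N by rewrite -mulnn; have := leq_mul D1 D1; clear; lia.
have LD : (L <= D * D)%N.
  by apply: leq_trans (_ : D <= _)%N; [rewrite leq_pmull|rewrite leq_pmulr].
have DE : (D * D = K1 ^ 2 * L ^ 2)%N by rewrite mulnn /D expnMn.
have -> : (720 * K1 ^ 4 * L ^ 4 = 720 * ((D * D) * (D * D)))%N.
  have -> : (K1 ^ 4 = K1 ^ 2 * K1 ^ 2)%N by rewrite -expnD.
  have -> : (L ^ 4 = L ^ 2 * L ^ 2)%N by rewrite -expnD.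
  by rewrite DE; move: (L ^ 2)%N (K1 ^ 2)%N => u v; clear; lia.
(* 720 is 30 times 24: 24 D^2 bounds [M], and 30 D^2 bounds the required quotient since D + 1 <= 2 D
   and L <= D^2. *)
rewrite [X in (_ <= X)%N](_ : _ = 30 * (D * D) * (24 * (D * D)))%N; last by clear; lia.
by rewrite leq_mul2r; apply/orP; right; move: DD LD; clear; lia.
Qed.

Lemma RR_archi (x : RR) : exists N : nat, x < N%:R.
Proof.
pose y : Rdefinitions.R := x; exists (Num.bound `|y|).
exact: le_lt_trans (ler_norm y) (archi_boundP (normr_ge0 y)).
Qed.

Lemma RR_pow_small (x e : RR) : 0 <= x -> x < 1 -> 0 < e ->
  exists2 K, (0 < K)%N & x ^+ K <= e.
Proof.
move=> x0 x1 e0.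
(* Bernoulli's inequality for 1/x, written without division. *)
have bern N : x ^+ N * (1 + N%:R * (1 - x)) <= 1.
  elim: N => [|N IHN]; first by rewrite expr0 mul0r addr0 mulr1.
  apply: le_trans IHN; rewrite exprSr -mulrA ler_wpM2l ?exprn_ge0 //.
  rewrite -natr1 -subr_ge0 (_ : _ - _ = (1 - x) * (1 - x) * (N%:R + 1)); last by ring.
  have x1' : 0 <= 1 - x by rewrite subr_ge0 ltW.
  by rewrite mulr_ge0 ?addr_ge0 ?mulr_ge0.
have [N Nbig] := RR_archi (1 / (e * (1 - x))).
exists N.+1 => //.
have c0 : 0 < e * (1 - x) by rewrite mulr_gt0 // subr_gt0.
rewrite ltr_pdivrMr // in Nbig.
have xN := exprn_ge0 N.+1 x0; have b := bern N.+1.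
rewrite -natr1 in b.
apply: (@le_trans _ _ (e * (x ^+ N.+1 * (N%:R * (1 - x))))).
  rewrite (_ : e * _ = x ^+ N.+1 * (N%:R * (e * (1 - x)))); last by ring.
  by rewrite ler_peMr // ltW.
rewrite -[leRHS]mulr1 ler_wpM2l ?(ltW e0) //; apply: le_trans b.
by rewrite ler_wpM2l //; move: (x1); lra.
Qed.

(** * Asymptotic estimates *)

Lemma half_pow_le (n L k : nat) : (n <= 2 ^ L)%N ->
  n%:R ^+ k * (2^-1) ^+ (k * L) <= 1 :> RR.
Proof.
move=> nL; rewrite mulnC exprM -exprMn exprn_ile1 ?mulr_ge0 ?exprn_ge0 ?invr_ge0 //.
by rewrite exprVn ler_pdivrMr ?exprn_gt0 // mul1r -natrX ler_nat.
Qed.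

(** The choice of [K1] makes the power at most n^-4. The extra factor [L%:R], in all three
    estimates, is the gain that turns a bound of order n^-2 into o(n^-2). *)
Lemma high_degree_estimate (a : RR) K1 n L : 0 <= a -> a ^+ K1 <= 2^-1 ^+ 4 ->
  (0 < n)%N -> (n <= 2 ^ L)%N -> (L <= n)%N ->
  n.+1%:R * a ^+ (K1 * L) * n%:R ^+ 2 * L%:R <= 2.
Proof.
move=> a0 aK n0 nL Ln.
have aL : a ^+ (K1 * L) <= 2^-1 ^+ (4 * L).
  by rewrite !exprM lerXn2r ?nnegrE ?exprn_ge0 ?invr_ge0.
have := half_pow_le 4 nL; move: aL; set u := a ^+ _; set v := _ ^+ (4 * L) => uv nv.
have u0 : 0 <= u by rewrite exprn_ge0.
apply: le_trans (_ : (2 * n%:R) * u * n%:R ^+ 2 * n%:R <= _).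
  rewrite ler_pM ?mulr_ge0 ?exprn_ge0 ?ler_nat // !ler_wpM2r ?exprn_ge0 //.
  by rewrite -natrM ler_nat; lia.
rewrite (_ : _ * n%:R = 2 * (n%:R ^+ 4 * u)); last by ring.
rewrite -[leRHS]mulr1 ler_wpM2l //; apply: le_trans nv.
by rewrite ler_wpM2l ?exprn_ge0.
Qed.

(** The exponent 13 is 4 + 8 + 1: L^4 from the number of roots of unity, L^8 from (n / 2^h)^2, and
    one more L as gain. The bad event is at most n^-4 times polylogarithmic factors. *)
Lemma low_order_estimate (b : RR) K1 K2 G n L h : 0 <= b -> b ^+ K2 <= 2^-1 ^+ 4 ->
  (0 < n)%N -> (0 < L)%N -> (n <= 2 ^ L)%N -> (L <= n)%N -> (h <= L)%N ->
  (n <= 2 * (2 ^ h * (G * L ^ 4)))%N -> (24 * K1 ^ 4 * L ^ 17 <= n)%N ->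
  ((2 * (K1 * L) ^ 2) ^ 2)%:R * ((4 ^+ h * (L ^ 13).+1%:R)^-1 +
     (2 * (h + 2 * L ^ 13))%:R * b ^+ (K2 * L)) * n%:R ^+ 2 * L%:R <=
  (16 * K1 ^ 4 * G ^ 2)%:R + 1.
Proof.
move=> b0 bK n0 L0 nL Ln hL nG nK; set B := ((2 * _) ^ 2)%N.
have BE : B = (4 * K1 ^ 4 * L ^ 4)%N by rewrite /B !expnS !expn0; clear; lia.
rewrite mulrDr !mulrDl lerD //.
  have : (B * n ^ 2 * L <= 16 * K1 ^ 4 * G ^ 2 * (4 ^ h * (L ^ 13).+1))%N.
    apply: leq_trans (_ : B * (2 * (2 ^ h * (G * L ^ 4))) ^ 2 * L <= _)%N.
      by rewrite leq_mul2r leq_mul2l leq_exp2r // nG !orbT.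
    apply: leq_trans (_ : 16 * K1 ^ 4 * G ^ 2 * (4 ^ h * L ^ 13) <= _)%N; last first.
      by rewrite !leq_mul2l leqnSn !orbT.
    have P4 : ((2 ^ h) ^ 2 = 4 ^ h)%N by rewrite -expnM mulnC expnM.
    have L13 : (L ^ 13 = L ^ 4 * (L ^ 4) ^ 2 * L)%N by rewrite -expnM -expnD -expnSr.
    have -> : ((2 * (2 ^ h * (G * L ^ 4))) ^ 2 = 4 * 4 ^ h * G ^ 2 * (L ^ 4) ^ 2)%N.
      by rewrite -P4 -!mulnn; move: (2 ^ h)%N (L ^ 4)%N => u v; clear; lia.
    rewrite BE L13; move: ((L ^ 4) ^ 2)%N (L ^ 4)%N (K1 ^ 4)%N (4 ^ h)%N (G ^ 2)%N => y u v w z.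
    by rewrite leq_eqVlt; apply/orP; left; apply/eqP; clear; lia.
  have c0 : 0 < (4 ^ h * (L ^ 13).+1)%:R :> RR by rewrite ltr0n muln_gt0 expn_gt0.
  rewrite -(ler_nat RR) [X in _ <= X -> _]natrM -ler_pdivrMr // => le.
  have e1 : (4 ^ h * (L ^ 13).+1)%:R = 4 ^+ h * (L ^ 13).+1%:R :> RR.
    by rewrite natrM natrX.
  have e2 : (B * n ^ 2 * L)%:R = B%:R * n%:R ^+ 2 * L%:R :> RR.
    by rewrite (natrM _ (B * n ^ 2)) (natrM _ B) (natrX _ n).
  apply: le_trans le; rewrite e1 e2; move: (_^-1) (B%:R) => z v.
  by rewrite le_eqVlt; apply/orP; left; apply/eqP; ring.
have bL : b ^+ (K2 * L) <= 2^-1 ^+ (4 * L).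
  by rewrite !exprM lerXn2r ?nnegrE ?exprn_ge0 ?invr_ge0.
have := half_pow_le 4 nL; move: bL; set u := b ^+ _; set v := _ ^+ (4 * L) => uv nv.
have u0 : 0 <= u by rewrite exprn_ge0.
have small : (B * (2 * (h + 2 * L ^ 13)) <= n)%N.
  apply: leq_trans nK; rewrite BE (_ : L ^ 17 = L ^ 4 * L ^ 13)%N; last by rewrite -expnD.
  have : (h <= L ^ 13)%N by apply: leq_trans hL _; rewrite -[leqLHS]expn1 leq_pexp2l.
  move: (L ^ 13)%N (L ^ 4)%N (K1 ^ 4)%N => y z w hy.
  apply: leq_trans (_ : 4 * w * z * (2 * (y + 2 * y)) <= _)%N; last by clear; lia.
  by rewrite leq_mul2l; apply/orP; right; lia.
rewrite (mulrA B%:R) -(natrM _ B).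
apply: le_trans (_ : n%:R * u * n%:R ^+ 2 * n%:R <= _).
  by rewrite ler_pM ?mulr_ge0 ?exprn_ge0 ?ler_nat // !ler_wpM2r ?exprn_ge0 // ler_nat.
rewrite (_ : _ * n%:R = n%:R ^+ 4 * u); last by ring.
by apply: le_trans nv; rewrite ler_wpM2l ?exprn_ge0.
Qed.

(** There are at most 2^(3 (D+1)^2) candidates. As rho^2 <= 1/2, the exponent [t] cancels this count
    and leaves 2^(-3L) <= n^-3. *)
Lemma far_conjugate_estimate (rho : RR) D n L t : 0 <= rho -> rho ^+ 2 <= 2^-1 ->
  (0 < n)%N -> (n <= 2 ^ L)%N -> (L <= n)%N ->
  (2 * (3 * D.+1 ^ 2 + 3 * L) <= t)%N ->
  ((2 * 3 ^ D).+1 ^ D.+1 * D)%:R * rho ^+ t * n%:R ^+ 2 * L%:R <= 1.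
Proof.
move=> r0 r2 n0 nL Ln Dt; have r1 : rho <= 1.
  by rewrite -(@ler_sqr _ rho 1) ?nnegrE // expr1n; move: r2; lra.
have cnt : ((2 * 3 ^ D).+1 ^ D.+1 * D <= 2 ^ (3 * D.+1 ^ 2))%N.
  have le3 : ((2 * 3 ^ D).+1 <= 2 ^ (2 * D.+1))%N.
    rewrite expnM -[(2 ^ 2)%N]/4%N expnS.
    have : (3 ^ D <= 4 ^ D)%N by case: (D) => // D'; rewrite leq_exp2r.
    have : (0 < 4 ^ D)%N by rewrite expn_gt0.
    by clear; lia.
  apply: leq_trans (_ : (2 ^ (2 * D.+1)) ^ D.+1 * 2 ^ D.+1 <= _)%N.
    apply: leq_mul; first by rewrite leq_exp2r.
    by apply: leq_trans (ltnW (ltn_expl D (isT : 1 < 2)%N)) _; rewrite leq_exp2l.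
  by rewrite -expnM -expnD leq_exp2l // -mulnn; clear; nia.
apply: le_trans (_ : (2 ^ (3 * D.+1 ^ 2))%:R * 2^-1 ^+ (3 * D.+1 ^ 2 + 3 * L) * n%:R ^+ 2 * n%:R <= _).
  rewrite ler_pM ?mulr_ge0 ?exprn_ge0 ?ler_nat // ler_wpM2r ?exprn_ge0 //.
  rewrite ler_pM ?exprn_ge0 ?ler_nat //.
  apply: le_trans (_ : rho ^+ (2 * (3 * D.+1 ^ 2 + 3 * L)) <= _).
    by rewrite ler_wiXn2l.
  by rewrite exprM lerXn2r ?nnegrE ?exprn_ge0 ?invr_ge0.
rewrite exprD natrX mulrA exprVn mulfV ?expf_neq0 ?pnatr_eq0 // mul1r.
apply: le_trans (half_pow_le 3 nL); rewrite -mulrA -exprSr mulrC.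
by rewrite exprVn.
Qed.

(** * Proof of the theorem *)

(** Otherwise a single atom would carry mass 1. *)
Lemma two_positive_atoms (p : 'I_3 -> RR) rho : is_distr3 p ->
  (forall t, p t <= rho) -> rho < 1 -> exists x y, x != y /\ 0 < p x * p y.
Proof.
move=> [p0 p1] p_le rho1; apply: contrapT => none.
have null x y : x != y -> p x * p y = 0.
  move=> xy; apply/eqP; rewrite eq_le mulr_ge0 // andbT leNgt.
  by apply/negP => pxy; apply: none; exists x, y.
have [x px] : exists x, p x != 0.
  apply: contrapT => np; move: p1; rewrite big1 => [/eqP|x _].
    by rewrite eq_sym oner_eq0.
  by apply/eqP/negPn/negP => px; apply: np; exists x.
move: p1; rewrite (bigD1 x) //= big1 ?addr0 => [px1|y yx].
  by have := le_lt_trans (p_le x) rho1; rewrite px1 ltxx.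
have /eqP : p x * p y = 0 by apply: null; rewrite eq_sym.
by rewrite mulf_eq0 (negPf px) => /eqP.
Qed.

Lemma max_atom (p : 'I_3 -> RR) : is_distr3 p ->
  (forall k, p k < 1 / Num.sqrt 3) ->
  exists rho, [/\ forall t, p t <= rho, 0 <= rho & 3 * rho ^+ 2 < 1].
Proof.
move=> [p0 p1] p_lt; exists (\big[Num.max/0]_k p k).
have r0 : 0 <= \big[Num.max/0]_k p k by exact: bigmax_ge_id.
split=> //; first by move=> t; exact: le_bigmax_cond.
have s3 : 0 < Num.sqrt 3 :> RR by rewrite sqrtr_gt0.
have : \big[Num.max/0]_k p k < 1 / Num.sqrt 3.
  by apply: bigmax_lt => //; rewrite divr_gt0.
rewrite ltr_pdivlMr // -(@ltr_sqr _ _ 1) ?nnegrE ?mulr_ge0 ?(ltW s3) //.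
by rewrite exprMn sqr_sqrtr // expr1n mulrC.
Qed.

Theorem theorem1p1 (p : 'I_3 -> RR) :
  is_distr3 p ->
  (forall k : 'I_3, p k < 1 / Num.sqrt 3) ->
  forall eps : RR, 0 < eps -> exists N : nat, forall n : nat, (N <= n)%N ->
    `| @prob p n (fun xi => exists z : CC, double_root (randpoly xi) z)
       - @prob p n (fun xi => double_root (randpoly xi) cm1
                          \/ double_root (randpoly xi) c0
                          \/ double_root (randpoly xi) c1) |
      * (n%:R) ^+ 2 < eps.
Proof.
move=> pd p_lt eps eps0; have [rho [p_le r0 r3]] := max_atom pd p_lt.
have r2 : rho ^+ 2 <= 2^-1 by move: r3; lra.
have r1 : rho < 1.
  by rewrite -(@ltr_sqr _ rho 1) ?nnegrE // expr1n; move: r2; lra.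
have [x [y [xy pxy]]] := two_positive_atoms pd p_le r1.
have a0 : 0 <= 3 * rho ^+ 2 by rewrite mulr_ge0 ?exprn_ge0.
have b1 : 1 - p x * p y < 1 by rewrite ltrBlDr ltrDl.
have b0 : 0 <= 1 - p x * p y.
  case: (pd) => p0 _; have pl1 t : p t <= 1 by exact: le_trans (p_le t) (ltW r1).
  by rewrite subr_ge0 -[1]mulr1 ler_pM.
have h0 : 0 < 2^-1 ^+ 4 :> RR by rewrite exprn_gt0 // invr_gt0.
have [K1 K10 aK] := RR_pow_small a0 r3 h0.
have [K2 K20 bK] := RR_pow_small b0 b1 h0.
pose G := (4 * K1 ^ 2 * K2.+1)%N.
(* [C] adds the constants of the three estimates; the threshold on [L] includes [c0.+1], so that [L]
   exceeds [C / eps]. *)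
pose C := 2 + ((16 * K1 ^ 4 * G ^ 2)%:R + 1) + 1 : RR.
have [c0 Cc0] := RR_archi (C / eps).
have [N NP] := up_log_pow_small (4 * K2.+1 * G + 720 * K1 ^ 4 + c0.+1) 18.
exists N => n Nn; have [cL cn] := NP n Nn; set L := up_log 2 n in cL cn.
have L0 : (0 < L)%N by apply: leq_trans cL; rewrite addnS.
have L18 : (L <= L ^ 18)%N by rewrite -[leqLHS]expn1 leq_pexp2l.
have Ln : (L <= n)%N.
  by apply: leq_trans L18 (leq_trans _ cn); rewrite leq_pmull // addnS.
have big : ((4 * K2.+1 * G + 720 * K1 ^ 4) * L ^ 18 <= n)%N.
  by apply: leq_trans cn; rewrite leq_mul2r leq_addr orbT.
have n0 : (0 < n)%N by exact: leq_trans Ln.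
have nL : (n <= 2 ^ L)%N by exact: up_logP.
have [h [K [M [[DK ME] M0 mr [Bn hL] [nG tM]]]]] := parameters K10 K20 L0 big.
have diff := prob_double_root_diff pd p_le (ltW r3) DK ME M0 erefl xy mr Bn.
have nK : (24 * K1 ^ 4 * L ^ 17 <= n)%N.
  apply: leq_trans big; apply: leq_mul; last by rewrite leq_pexp2l.
  by apply: leq_trans (leq_addl _ _); rewrite leq_mul2r orbT.
have T1 := high_degree_estimate a0 aK n0 nL Ln.
have T2 := low_order_estimate b0 bK n0 L0 nL Ln hL nG nK.
have T3 := far_conjugate_estimate r0 r2 n0 nL Ln tM.
have LR : 0 < L%:R :> RR by rewrite ltr0n.
rewrite -(ltr_pM2r LR); apply: (@le_lt_trans _ _ C); last first.
  rewrite mulrC -ltr_pdivrMr //; apply: lt_le_trans Cc0 _.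
  by rewrite ler_nat; apply: leq_trans cL; rewrite addnS ltnW // ltnS leq_addl.
have n2 : 0 <= n%:R ^+ 2 :> RR by rewrite exprn_ge0.
apply: le_trans (ler_wpM2r (ltW LR) (ler_wpM2r n2 diff)) _.
by apply: le_trans (lerD (lerD T1 T2) T3); rewrite -!mulrDl.
Qed.
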